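(* Let $\Omega\subset\mathbb{R}^3$ be a non-empty, connected open set and let $\bm{H}\colon\Omega\to\mathbb{R}^3$ be a continuously differentiable vector field satisfying $\nabla\cdot\bm{H}=0$ and $\nabla\times\bm{H}=0$ on $\Omega$. Then no level set of $\bm{H}$, i.e. no set of the form $\{\bm{x}\in\Omega : \bm{H}(\bm{x})=\bm{c}\}$ with $\bm{c}\in\mathbb{R}^3$, is a $2$-dimensional regular surface in $\Omega$.
   Context: A $2$-dimensional regular surface $\mathcal{S}\subset\Omega$ is a (embedded) $C^1$ submanifold of dimension $2$, i.e. locally the image of a $C^1$ parametrization $\varphi(\tau,\sigma)$ with linearly independent partial derivatives, so that the tangent space at every point is $2$-dimensional. *)

(* Defs.v *)
From HB Require Import structures.
From mathcomp Require Import all_boot all_order all_algebra.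
From mathcomp Require Import all_classical all_reals all_analysis.
Set Implicit Arguments. Unset Strict Implicit. Unset Printing Implicit Defensive.
Import Order.TTheory GRing.Theory Num.Theory.
Import numFieldNormedType.Exports.
Local Open Scope classical_set_scope.
Local Open Scope ring_scope.

Definition ev {R : realType} {n : nat} (i : 'I_n) : 'rV[R]_n := delta_mx 0 i.

Definition comp {R : realType} {n : nat} (v : 'rV[R]_n) (j : 'I_n) : R := v 0 j.

Definition pderiv {R : realType} {n m : nat} (f : 'rV[R]_n -> 'rV[R]_m)
  (i : 'I_n) (x : 'rV[R]_n) : 'rV[R]_m := 'D_(ev i) f x.

Definition C1_on {R : realType} {n m : nat} (A : set 'rV[R]_n)
  (f : 'rV[R]_n -> 'rV[R]_m) : Prop :=
  (forall x, A x -> differentiable f x) /\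
  (forall (i : 'I_n) x, A x -> {for x, continuous (pderiv f i)}).

Definition div3 {R : realType} (H : 'rV[R]_3 -> 'rV[R]_3) (x : 'rV[R]_3) : R :=
  \sum_(i < 3) comp (pderiv H i x) i.

Definition curl3 {R : realType} (H : 'rV[R]_3 -> 'rV[R]_3) (x : 'rV[R]_3)
  : 'rV[R]_3 :=
  let d i j := comp (pderiv H i x) j in
  \row_(k < 3)
    (if k == 0 :> nat then d 1 2 - d 2 1
     else if k == 1 :> nat then d 2 0 - d 0 2
     else d 0 1 - d 1 0).

(* S is a (non-empty) 2-dimensional regular surface contained in Omega:
   an embedded C^1 submanifold of dimension 2 of R^3, i.e. every point p of S
   has an open neighbourhood U in R^3 such that S ∩ U is the homeomorphic
   image of an open set V of R^2 under a C^1 map phi with linearly independent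
   partial derivatives. *)
Definition regular_surface {R : realType} (Omega S : set 'rV[R]_3) : Prop :=
  S !=set0 /\ S `<=` Omega /\
  forall p, S p ->
    exists (U : set 'rV[R]_3) (V : set 'rV[R]_2)
           (phi : 'rV[R]_2 -> 'rV[R]_3) (psi : 'rV[R]_3 -> 'rV[R]_2),
      open U /\ U p /\ open V /\
          C1_on V phi /\
          (forall q, V q -> row_free (col_mx (pderiv phi 0 q) (pderiv phi 1 q))) /\
          (forall q, V q -> (S `&` U) (phi q) /\ psi (phi q) = q) /\
          (forall x, (S `&` U) x -> V (psi x) /\ phi (psi x) = x) /\
          {within S `&` U, continuous psi}.

(* Main.v *)
(* A level set S of H on which H = c is, near each of its points p, a graph
   gamma = 0 over a coordinate plane.  On S the Jacobian of H is symmetric and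
   traceless and kills two independent tangent vectors, hence vanishes.  So
   H - c above S, extended by 0 below S, is still C^1, divergence free and curl
   free; integrating it vertically gives a harmonic potential h that vanishes
   below S.  The maximum principle, with a quadratic barrier, bounds the
   symmetric difference quotients of bounded harmonic functions; iterating it
   bounds n-fold differences well enough for h to vanish a little above S too.
   There H = c, although these points are not on S. *)
Require Import Defs.
From HB Require Import structures.
From mathcomp Require Import all_boot all_order all_algebra.
From mathcomp Require Import all_classical all_reals all_analysis.
From mathcomp Require Import ring lra zify.
Import Order.TTheory GRing.Theory Num.Theory.
Import numFieldNormedType.Exports.
Local Open Scope classical_set_scope.
Local Open Scope ring_scope.

Set Implicit Arguments.
Unset Strict Implicit.
Unset Printing Implicit Defensive.

(** * Derivatives and mean value estimates in one real variable *)

Section RealLine.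
Variable R : realType.
Implicit Types (f g : R -> R) (a b t x : R).

(** The classical route is analyticity of harmonic fields and unique continuation. Here derivatives
    along coordinate lines, one-variable primitives and the maximum principle take its place, and
    the bounds on n-fold differences play the role of Cauchy estimates for derivatives of order n.
    The obstacle is that [H] is merely $C^1$: the components of the extended field need not have
    second derivatives, so no maximum principle applies to them. A potential gains one derivative:
    its gradient is the field and its Laplacian is the divergence of the field. Starting the
    vertical integration below the surface makes the potential vanish there. After the Jacobian is
    known to vanish on the surface, the shape of the surface matters only through a continuous
    [gamma] that grows at unit speed in one coordinate direction. Extension by zero across
    [gamma = 0] needs no smoothness of [gamma], since [H - c] and its first derivatives all vanish
    there. *)

Lemma is_derive_normP f x a :
  is_derive x 1 f a <->
  forall e : R, 0 < e -> \forall h \near 0, `|f (x + h) - f x - a * h| <= e * `|h|.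
Proof.
have key e h : h != 0 -> (`|a - h^-1 *: (f (h *: 1 + x) - f x)| <= e) =
    (`|f (x + h) - f x - a * h| <= e * `|h|).
  move=> h0; rewrite -[LHS](ler_pM2r (_ : 0 < `|h|)) ?normr_gt0// -normrM.
  rewrite -normrN; congr (`| _ | <= _); rewrite /GRing.scale/= mulr1 addrC.
  by rewrite [h + x]addrC; field.
split=> [[df Df] e e0|H].
- have : h^-1 *: ((f \o shift x) (h *: 1) - f x) @[h --> 0^'] --> a.
    by rewrite -Df; exact: df.
  move=> /cvgrPdist_le/(_ e e0) H.
  have {}H : \forall h \near 0, h != 0 ->
     `|a - h^-1 *: (f (h *: 1 + x) - f x)| <= e.
    by move: H; rewrite /dnbhs near_withinE.
  near=> h; have [->|h0] := eqVneq h 0; first by rewrite addr0 mulr0 !subr0 subrr !normr0 mulr0.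
  by rewrite -key//; move: (h0); near: h.
- have C : h^-1 *: ((f \o shift x) (h *: 1) - f x) @[h --> 0^'] --> a.
    apply/cvgrPdist_le => e e0; have He := H e e0.
    rewrite /dnbhs near_withinE; near=> h => h0.
    by rewrite /= key//; near: h.
  by apply: DeriveDef; [apply/cvg_ex; exists a|exact: cvg_lim].
Unshelve. all: by end_near. Qed.

Lemma is_derive_shift f x b a :
  is_derive (x + b) 1 f a -> is_derive x 1 (fun t => f (t + b)) a.
Proof.
move=> /is_derive_normP H; apply/is_derive_normP => e /H.
by apply: filterS => h; rewrite [x + h + b]addrAC.
Qed.

Lemma is_derive_opp f x a :
  is_derive (- x) 1 f a -> is_derive x 1 (fun t => f (- t)) (- a).
Proof.
move=> df; have -> : - a = a * (- 1) by rewrite mulrN1.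
by apply: (@is_derive1_comp _ f (-%R)); exact: is_deriveN.
Qed.

Lemma is_derive_continuous f x a : is_derive x 1 f a -> {for x, continuous f}.
Proof. by move=> [df _]; apply/differentiable_continuous/derivable1_diffP. Qed.

Lemma MVT_norm f g (a b M : R) : a <= b ->
  (forall t, a <= t <= b -> is_derive t 1 f (g t)) ->
  (forall t, a <= t <= b -> `|g t| <= M) -> `|f b - f a| <= M * (b - a).
Proof.
move=> ab df gM.
have [t||t tab] := @MVT_segment R f g a b ab.
- by rewrite in_itv/= => /andP[/ltW ? /ltW ?]; apply: df; apply/andP.
- apply: continuous_in_subspaceT => t; rewrite inE/= in_itv/= => tab.
  exact: is_derive_continuous (df t tab).
move=> ->; rewrite normrM (ger0_norm (_ : 0 <= b - a)) ?subr_ge0//.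
by rewrite ler_wpM2r ?subr_ge0//; apply: gM; move: tab; rewrite in_itv.
Qed.

Lemma MVT_norm_sym f g t0 (s M : R) :
  (forall t, `|t| <= `|s| -> is_derive (t0 + t) 1 f (g t)) ->
  (forall t, `|t| <= `|s| -> `|g t| <= M) -> `|f (t0 + s) - f t0| <= M * `|s|.
Proof.
move=> df gM; have [s0|s0] := leP 0 s.
- have := @MVT_norm (fun t => f (t + t0)) g 0 s M s0.
  rewrite add0r subr0 [s + t0]addrC (ger0_norm s0); apply.
  + move=> t /andP[t0' ts]; apply: is_derive_shift; rewrite addrC; apply: df.
    by rewrite !ger0_norm// (le_trans _ ts).
  + by move=> t /andP[t0' ts]; apply: gM; rewrite !ger0_norm// (le_trans _ ts).
- have := @MVT_norm (fun t => f (t + t0)) g s 0 M (ltW s0).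
  rewrite add0r sub0r [s + t0]addrC (distrC (f t0)) (ltr0_norm s0); apply.
  + move=> t /andP[t0' ts]; apply: is_derive_shift; rewrite addrC; apply: df.
    by rewrite !ler0_norm ?lerN2// ltW.
  + by move=> t /andP[t0' ts]; apply: gM; rewrite !ler0_norm ?lerN2// ltW.
Qed.

(** At the maximum [g 0 = 0]. If [w > 0], then [g t >= w / 2 * t > 0] for small positive [t], and
    the mean value theorem makes [f] exceed [f 0]. *)
Lemma second_derivative_le0 f g (w : R) :
  (\forall t \near (0 : R), is_derive (t : R) 1 f (g t)) -> is_derive (0 : R) 1 g w ->
  (\forall t \near (0 : R), f t <= f 0) -> w <= 0.
Proof.
move=> df dg fmax; rewrite leNgt; apply/negP => w0.
have g0 : g 0 = 0.
  have : \forall t \near (0 : R), is_derive (t : R) 1 f (g t) /\ f t <= f 0 by near=> t; split; near: t.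
  move=> /nbhs_ballP[e /= e0 He].
  have B t : t \in `]-e, e[ -> is_derive t 1 f (g t) /\ f t <= f 0.
    by rewrite in_itv/= => te; apply: He; rewrite /ball/= sub0r normrN ltr_norml.
  have i0 : (0 : R) \in `]-e, e[ by rewrite in_itv/= oppr_lt0 e0.
  have [|t|t|_] := @derive1_at_max _ f (-e) e 0 _ _ i0.
  - by lra.
  - by move=> /B[[]].
  - by move=> /B[].
  - by case: (B 0 i0) => [[_ ->]].
have /is_derive_normP/(_ (w / 2) ltac:(by rewrite divr_gt0)) := dg.
rewrite g0 => gw.
have : \forall t \near (0 : R), [/\ is_derive (t : R) 1 f (g t), f t <= f 0 & `|g (0 + t) - 0 - w * t| <= w / 2 * `|t| ].
  by near=> t; split; near: t.
move=> /nbhs_ballP[e /= e0 He].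
have e2 : 0 < e / 2 by rewrite divr_gt0.
have B t : 0 <= t <= e / 2 -> [/\ is_derive t 1 f (g t), f t <= f 0 & `|g (0 + t) - 0 - w * t| <= w / 2 * `|t| ].
  by move=> te; apply: He; rewrite /ball/= sub0r normrN ger0_norm; lra.
have [t||t] := @MVT R f g 0 (e / 2) e2.
- by rewrite in_itv/= => te; case: (B t) => //; lra.
- apply: continuous_in_subspaceT => t; rewrite inE/= in_itv/= => te.
  by case: (B t te) => /is_derive_continuous.
rewrite in_itv/= => te ft; have [|_ fe _] := B (e / 2); first by lra.
have [|_ _] := B t; first by lra.
rewrite add0r subr0 (gtr0_norm (_ : 0 < t)) ?ler_norml; last by lra.
move=> /andP[gt _]; have wt : 0 < w * t by rewrite mulr_gt0//; lra.
have g_gt0 : 0 < g t by lra.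
have : 0 < g t * (e / 2) by rewrite mulr_gt0.
by move: ft; rewrite subr0 => <-; lra.
Unshelve. all: by end_near. Qed.

End RealLine.

(** * The Laplacian along coordinate lines and the maximum principle *)

Section Harmonic.
Variable R : realType.
Implicit Types (u v : 'rV[R]_3 -> R) (x y c p : 'rV[R]_3) (i k : 'I_3).

Lemma is_derive_subZ (f g : R -> R) (t a b c : R) :
  is_derive t 1 f a -> is_derive t 1 g b ->
  is_derive t 1 (fun s => f s - c * g s) (a - c * b).
Proof. by move=> df dg; exact: (is_deriveB df (is_deriveZ c dg)). Qed.

Lemma is_derive_quad (a b c d t : R) :
  is_derive t 1 (fun s => d + (a * (b + s) ^+ 2 + c * (b + s)))
    (2 * a * (b + t) + c).
Proof.
have H : is_derive t 1 (fun s : R => b + s) 1.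
  by rewrite -[X in is_derive _ _ _ X]add0r; exact: is_deriveD.
have D := is_deriveD (is_derive_cst d t 1)
  (is_deriveD (is_deriveZ a (is_deriveX 2 H)) (is_deriveZ c H)).
by apply: (is_derive_eq D); rewrite /GRing.scale/=; ring.
Qed.

Lemma comp_addZ x (t : R) i j : (x + t *: ev i) 0 j = x 0 j + (i == j)%:R * t.
Proof. by rewrite !mxE eqxx/= mulrC eq_sym. Qed.

Lemma line_continuous x i : continuous (fun s : R => x + s *: ev i).
Proof.
move=> t; apply: cvgD; first exact: cvg_cst.
by apply: cvgZr_tmp; exact: cvg_id.
Qed.

(* g i is the i-th partial derivative of u, but only along the i-th coordinate
   line through x: no joint regularity is asked for. *)
Definition has_laplacian u x (L : R) :=
  exists (g : 'I_3 -> R -> R) (w : 'I_3 -> R),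
  [/\ forall i, \forall t \near (0 : R),
        is_derive (t : R) 1 (fun s => u (x + s *: ev i)) (g i t),
      forall i, is_derive (0 : R) 1 (g i) (w i)
    & \sum_i w i = L].

Lemma has_laplacian_subZ u v x (K L c : R) :
  has_laplacian u x K -> has_laplacian v x L ->
  has_laplacian (fun y => u y - c * v y) x (K - c * L).
Proof.
move=> [g [w [ug gw wK]]] [g' [w' [vg' gw' wL]]].
exists (fun i t => g i t - c * g' i t), (fun i => w i - c * w' i); split.
- move=> i; near=> t; apply: is_derive_subZ; first by near: t; exact: ug.
  by near: t; exact: vg'.
- by move=> i; apply: is_derive_subZ.
- by rewrite sumrB -mulr_sumr wK wL.
Unshelve. all: by end_near. Qed.

Lemma has_laplacian_translate u x a (L : R) :
  has_laplacian u (x + a) L -> has_laplacian (fun y => u (y + a)) x L.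
Proof.
move=> [g [w [ug gw wL]]]; exists g, w; split => // i.
suff -> : (fun s => u (x + s *: ev i + a)) = (fun s => u (x + a + s *: ev i)).
  exact: ug.
by apply/funext => s; rewrite addrAC.
Qed.

Definition reflect k (b : R) x := x - (2 * (x 0 k - b)) *: ev k.

Lemma reflect_addZ k b x (t : R) i :
  reflect k b (x + t *: ev i) =
  reflect k b x + (if i == k then - t else t) *: ev i.
Proof.
rewrite /reflect comp_addZ; apply/rowP => j; rewrite !mxE/=.
have [->|ik] := eqVneq i k; last by rewrite mul0r addr0; ring.
by case: (j == k); rewrite /=; ring.
Qed.

(** In direction [k] the sign flips once in each of the two differentiations, so [w k] is
    unchanged. *)
Lemma has_laplacian_reflect u k b x (L : R) :
  has_laplacian u (reflect k b x) L ->
  has_laplacian (fun y => u (reflect k b y)) x L.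
Proof.
move=> [g [w [ug gw wL]]].
exists (fun i t => if i == k then - g i (- t) else g i t), w; split => // i.
- have -> : (fun s => u (reflect k b (x + s *: ev i))) =
     (fun s => u (reflect k b x + (if i == k then - s else s) *: ev i)).
    by apply/funext => s; rewrite reflect_addZ.
  have [->|ik] := eqVneq i k; last exact: ug.
  have : \forall t \near (0 : R), is_derive (- t : R) 1
     (fun s => u (reflect k b x + s *: ev k)) (g k (- t)).
    by apply/(nearN 0 (fun t => is_derive (t : R) 1
      (fun s => u (reflect k b x + s *: ev k)) (g k t))); rewrite oppr0; exact: ug.
  by apply: filterS => t; exact: (@is_derive_opp _ (fun s => u (reflect k b x + s *: ev k))).
- have [->|ik] := eqVneq i k; last exact: gw.
  have := @is_derive_opp _ (g k) 0 (w k); rewrite oppr0 => /(_ (gw k)).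
  by move=> /(@is_deriveN _ _ _ _ _ _ _); rewrite opprK.
Qed.

(** Separated quadratics serve twice: as the perturbation in [maximum_principle] and as the barrier
    in [symdiff_le]. *)
Lemma has_laplacian_quad (a b : 'I_3 -> R) c x :
  has_laplacian (fun y => \sum_i (a i * (y 0 i - c 0 i) ^+ 2 + b i * (y 0 i - c 0 i)))
    x (2 * \sum_i a i).
Proof.
exists (fun i t => 2 * a i * (x 0 i - c 0 i + t) + b i), (fun i => 2 * a i).
split; last by rewrite mulr_sumr.
- move=> i; near=> t.
  pose d := \sum_(j | j != i) (a j * (x 0 j - c 0 j) ^+ 2 + b j * (x 0 j - c 0 j)).
  have -> : (fun s => \sum_j (a j * ((x + s *: ev i) 0 j - c 0 j) ^+ 2 +
       b j * ((x + s *: ev i) 0 j - c 0 j))) =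
     (fun s => d + (a i * ((x 0 i - c 0 i) + s) ^+ 2 + b i * ((x 0 i - c 0 i) + s))).
    apply/funext => s; rewrite (bigD1 i)//= addrC; congr (_ + _).
      by apply: eq_bigr => j ji; rewrite comp_addZ eq_sym (negPf ji) mul0r addr0.
    by rewrite comp_addZ eqxx mul1r -(addrAC (x 0 i)).
  exact: is_derive_quad.
- move=> i.
  have := is_derive_quad 0 (x 0 i - c 0 i) (2 * a i) (b i) 0.
  rewrite mulr0 mul0r add0r; congr is_derive.
  by apply/funext => s; rewrite mul0r add0r; ring.
Unshelve. all: by end_near. Qed.

Lemma quad_continuous (a b : 'I_3 -> R) c :
  continuous (fun y : 'rV[R]_3 =>
    \sum_i (a i * (y 0 i - c 0 i) ^+ 2 + b i * (y 0 i - c 0 i)) : R).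
Proof.
move=> y; apply: (@cvg_big R _ _ 0 xpredT add_continuous _ (nbhs y)
  (index_enum _) (fun i y => a i * (y 0 i - c 0 i) ^+ 2 + b i * (y 0 i - c 0 i))).
move=> i _.
have D : {for y, continuous (fun z : 'rV[R]_3 => z 0 i)} by exact: coord_continuous.
have C : {for y, continuous (fun z : 'rV[R]_3 => z 0 i - c 0 i)}.
  by apply: (continuousB D); exact: cst_continuous.
have E r : {for y, continuous (fun z : 'rV[R]_3 => r : R)} by exact: cst_continuous.
by apply: (continuousD (continuousM (E (a i)) (continuousM C C)) (continuousM (E (b i)) C)).
Qed.

(** Adding a small multiple of the squared distance to [x0] makes the Laplacian strictly positive,
    which is impossible at an interior maximum. The disjunction in the hypothesis stands in for the
    boundary of [K]. *)
Lemma maximum_principle (K : set 'rV[R]_3) u (m : R) : compact K ->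
  (forall x, K x -> {for x, continuous u}) ->
  (forall x, K x -> u x <= m \/ nbhs x K /\ has_laplacian u x 0) ->
  forall x, K x -> u x <= m.
Proof.
move=> cK cu H x0 Kx0; rewrite leNgt; apply/negP => mx0.
pose q y := \sum_i (1 * (y 0 i - x0 0 i) ^+ 2 + 0 * (y 0 i - x0 0 i)).
have q0 y : 0 <= q y by apply: sumr_ge0 => i _; rewrite mul0r addr0 mul1r sqr_ge0.
have cq : continuous q by exact: quad_continuous.
have qx0 : q x0 = 0.
  by apply: big1 => i _; rewrite subrr expr0n/= !mulr0 addr0.
have K0 : K !=set0 by exists x0.
have [z /set_mem Kz zM] : exists2 z, z \in K & forall t, t \in K -> q t <= q z.
  by apply: EVT_max_rV => //; apply: continuous_subspaceT.
(* Small enough that [e * q] stays below [u x0 - m] on [K], so the perturbed maximum cannot sit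
   where [u <= m]; the [1 +] covers [q z = 0]. *)
pose e := (u x0 - m) / (1 + q z).
have qz1 : 0 < 1 + q z by rewrite ltr_wpDr.
have e0 : 0 < e by rewrite divr_gt0// subr_gt0.
have eq_lt y : K y -> e * q y < u x0 - m.
  move=> Ky; rewrite /e mulrAC ltr_pdivrMr// ltr_pM2l ?subr_gt0//.
  by rewrite (le_lt_trans (zM y _)) ?inE// ltrDr.
pose v y := u y - (- e) * q y.
have cv : {within K, continuous v}.
  apply: continuous_in_subspaceT => y; rewrite inE => Ky.
  apply: (continuousB (cu y Ky)).
  by apply: (@continuousM _ _ (fun=> - e)); [exact: cst_continuous|exact: cq].
have [y /set_mem Ky yM] := EVT_max_rV K0 cK cv.
have vy : v x0 <= v y by apply: yM; rewrite inE.
have [uy|[Ny Ly]] := H y Ky.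
  by move: vy; rewrite /v qx0; have := eq_lt y Ky; lra.
have [g [w [vg gw wL]]] := has_laplacian_subZ (- e) Ly (has_laplacian_quad (fun=> 1) (fun=> 0) x0 y).
have w0 i : w i <= 0.
  apply: (@second_derivative_le0 _ (fun s => v (y + s *: ev i)) (g i)) => //.
  - exact: vg.
  - rewrite scale0r addr0.
    have := @line_continuous y i 0; rewrite /continuous_at scale0r addr0.
    move=> /(_ _ Ny) N; near=> s; apply: yM; rewrite inE.
    by near: s; exact: N.
(* The Laplacian of [v] is [6 * e > 0]. *)
have : \sum_i w i <= 0 by apply: sumr_le0 => i _.
by rewrite wL sumr_const card_ord; lra.
Unshelve. all: by end_near. Qed.

End Harmonic.

(** * The norm on row vectors as a sup norm: its balls are cubes *)

Section Norm.
Variables (R : realType) (n : nat).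
Implicit Types (x y : 'rV[R]_n).

Lemma rV_norm_le x (r : R) : 0 <= r -> (`|x| <= r) <-> (forall i, `|x 0 i| <= r).
Proof.
move=> r0; have -> : `|x| = mx_norm x by [].
rewrite mx_normrE; split=> [H i|H].
- by apply: le_trans H; exact: (le_bigmax _ (fun ij => `|x ij.1 ij.2|) (0, i)).
- by apply: bigmax_le => // -[i j] _; rewrite /= ord1.
Qed.

Lemma rV_subE x y i : (x - y) 0 i = x 0 i - y 0 i.
Proof. by rewrite !mxE. Qed.

Lemma rV_norm_coord x i : `|x 0 i| <= `|x|.
Proof. by apply: (iffLR (rV_norm_le x (normr_ge0 x))). Qed.

Lemma rV_norm_attained x : 0 < `|x| -> exists i, `|x 0 i| = `|x|.
Proof.
move=> x0; have [|[i j] /= E] := @mx_norm_neq0 R 1 n x; first by rewrite gt_eqF.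
by exists j; rewrite -[RHS]/(mx_norm x) E ord1.
Qed.

Lemma rV_norm_ev (i : 'I_n) : `|ev i : 'rV[R]_n| <= 1.
Proof.
by apply/rV_norm_le => // j; rewrite !mxE; case: (_ && _); rewrite ?normr1 ?normr0.
Qed.

Lemma rV_norm_scale_ev (t : R) (i : 'I_n) : `|t *: ev i : 'rV[R]_n| <= `|t|.
Proof. by rewrite normrZ ler_piMr// rV_norm_ev. Qed.

End Norm.

(** * Symmetric differences of bounded harmonic functions *)

Section SymmetricDifference.
Variable R : realType.
Implicit Types (u v : 'rV[R]_3 -> R) (x y c p : 'rV[R]_3) (i k : 'I_3).

(** Continuity is added because [has_laplacian] only sees the coordinate lines through [x]. *)
Definition harmonic_at u x := {for x, continuous u} /\ has_laplacian u x 0.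

Lemma harmonic_at_sub u v x :
  harmonic_at u x -> harmonic_at v x -> harmonic_at (fun y => u y - v y) x.
Proof.
move=> [cu Lu] [cv Lv]; split; first exact: continuousB.
have := has_laplacian_subZ 1 Lu Lv; rewrite mulr0 subr0.
by congr has_laplacian; apply/funext => y; rewrite mul1r.
Qed.

Lemma harmonic_at_translate u x a :
  harmonic_at u (x + a) -> harmonic_at (fun y => u (y + a)) x.
Proof.
move=> [cu Lu]; split; last exact: has_laplacian_translate.
apply: (@continuous_comp _ _ _ (fun y => y + a) u) => //.
by apply: (@continuousD _ _ _ id (fun=> a)); [exact: cvg_id|exact: cst_continuous].
Qed.

Lemma reflect_continuous k (b : R) : continuous (reflect k b).
Proof.
move=> x; apply: (@continuousB _ _ _ id); first exact: cvg_id.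
apply: (@continuousZ _ _ _ (fun y : 'rV[R]_3 => 2 * (y 0 k - b)) (fun=> ev k)); last exact: cst_continuous.
apply: (@continuousM _ _ (fun=> 2)); first exact: cst_continuous.
apply: (@continuousB _ _ _ (fun y : 'rV[R]_3 => y 0 k) (fun=> b)); last exact: cst_continuous.
exact: coord_continuous.
Qed.

Lemma harmonic_at_reflect u k b x :
  harmonic_at u (reflect k b x) -> harmonic_at (fun y => u (reflect k b y)) x.
Proof.
move=> [cu Lu]; split; last exact: has_laplacian_reflect.
by apply: continuous_comp => //; exact: reflect_continuous.
Qed.

Lemma reflectE k (b : R) x j :
  (reflect k b x) 0 j = if j == k then 2 * b - x 0 k else x 0 j.
Proof.
by rewrite !mxE/=; have [->|_] := eqVneq j k; rewrite /= ?mulr1 ?mulr0 ?subr0//; ring.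
Qed.

Lemma reflect_center k c (t : R) :
  reflect k (c 0 k) (c + t *: ev k) = c - t *: ev k.
Proof.
apply/rowP => j; rewrite -scaleNr reflectE !comp_addZ eqxx (eq_sym k).
by have [->|_] := eqVneq j k; rewrite /= ?mulr1n ?mulr0n; ring.
Qed.

Lemma norm_reflect k c x (r : R) : `|x - c| <= r -> `|reflect k (c 0 k) x - c| <= r.
Proof.
move=> xr; have r0 : 0 <= r by exact: le_trans xr.
apply/rV_norm_le => // j; rewrite rV_subE reflectE.
move/(rV_norm_le _ r0)/(_ j): xr; rewrite rV_subE.
by have [->|//] := eqVneq j k; rewrite distrC; congr (`| _ | <= _); ring.
Qed.

(* On the half cube 0 <= y_k - c_k, the odd part of u vanishes on the mid
   plane and is dominated by 2M/d^2 times the harmonic barrier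
   \sum_(i != k) z_i^2 + z_k (3 d - 2 z_k), where z = y - c. *)
Lemma symdiff_le u c k (d M s : R) : 0 < d -> 0 <= s <= d ->
  (forall x, `|x - c| <= d -> harmonic_at u x /\ `|u x| <= M) ->
  u (c + s *: ev k) - u (c - s *: ev k) <= 6 * M * (s / d).
Proof.
move=> d0 /andP[s0 sd] Hu.
have M0 : 0 <= M.
  by have [_] := Hu c ltac:(by rewrite subrr normr0 ltW); apply: le_trans.
pose K := [set y : 'rV[R]_3 | `|y - c| <= d /\ c 0 k <= y 0 k].
(* The leading coefficients sum to [-2 + 1 + 1 = 0], which makes the barrier harmonic. *)
pose a i : R := if i == k then - 2 else 1.
pose b i : R := if i == k then 3 * d else 0.
pose B y := \sum_i (a i * (y 0 i - c 0 i) ^+ 2 + b i * (y 0 i - c 0 i)).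
have BE y : B y = (y 0 k - c 0 k) * (3 * d - 2 * (y 0 k - c 0 k)) +
    \sum_(i | i != k) (y 0 i - c 0 i) ^+ 2.
  rewrite /B (bigD1 k)//= /a /b eqxx; congr (_ + _); first by ring.
  by apply: eq_bigr => i /negPf ->; rewrite mul1r mul0r addr0.
pose N := 2 * M / d ^+ 2.
have d20 : 0 < d ^+ 2 by rewrite exprn_gt0.
have N0 : 0 <= N by rewrite divr_ge0 ?mulr_ge0// ltW.
pose v y := (u y - u (reflect k (c 0 k) y)) - N * B y.
have sum0 y : 0 <= \sum_(i | i != k) (y 0 i - c 0 i) ^+ 2.
  by apply: sumr_ge0 => i _; rewrite sqr_ge0.
have Hv y : `|y - c| <= d -> harmonic_at v y.
  move=> yd; have [hu _] := Hu y yd; have [hr _] := Hu _ (norm_reflect k yd).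
  have [C L] := harmonic_at_sub hu (harmonic_at_reflect hr); split.
    apply: (continuousB C); apply: (@continuousM _ _ (fun=> N)); first exact: cst_continuous.
    exact: quad_continuous.
  have := has_laplacian_subZ N L (has_laplacian_quad a b c y).
  suff -> : \sum_i a i = 0 by rewrite !mulr0 subr0.
  rewrite (bigD1 k)//= (eq_bigr (fun=> 1)) => [|i /negPf ik]; last by rewrite /a ik.
  by rewrite /a eqxx sumr_const cardC1 card_ord/= mulr2n; lra.
have K_compact : compact K.
  have -> : K = closed_ball c d `&` [set y : 'rV[R]_3 | c 0 k <= y 0 k].
    by rewrite closed_ballE// /K /closed_ball_; apply/seteqP; split => y /=; rewrite distrC.
  apply: bounded_closed_compact.
    exists (`|c| + d); split => [|r dr y [+ _]]; first exact: num_real.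
    rewrite closed_ballE// /closed_ball_/= => yd.
    rewrite (le_trans _ (ltW dr))// -[y](subrK c) addrC (le_trans (ler_normD _ _))//.
    by rewrite lerD2l distrC.
  apply: closedI.
    exact: closed_ball_closed.
  apply: (@closed_comp _ _ (fun y : 'rV[R]_3 => y 0 k) [set t | c 0 k <= t]).
    by move=> y _; exact: coord_continuous.
  exact: closed_ge.
have main : forall x, K x -> v x <= 0.
  apply: maximum_principle => // x [xd ck]; first exact: (Hv x xd).1.
  have [xk|xk] := eqVneq (x 0 k) (c 0 k).
    left; rewrite /v BE xk subrr mul0r add0r.
    have -> : reflect k (c 0 k) x = x.
      by rewrite /reflect xk subrr mulr0 scale0r subr0.
    by rewrite subrr sub0r oppr_le0 mulr_ge0.
  have [xd'|xd'] := ltP `|x - c| d.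
    right; split; last exact: (Hv x xd).2.
    have xk' : c 0 k < x 0 k by rewrite lt_neqAle eq_sym xk.
    have N1 : \forall y \near x, `|y - c| < d.
      have : {for x, continuous (fun y => `|y - c|)}.
        apply: (@continuous_comp _ _ _ (fun y => y - c) Num.norm); last exact: norm_continuous.
        by apply: (@continuousB _ _ _ id); [exact: cvg_id|exact: cst_continuous].
      by move=> /(cvgr_lt _)/(_ _ xd').
    have N2 : \forall y \near x, c 0 k < (y : 'rV[R]_3) 0 k.
      by have /(cvgr_gt _)/(_ _ xk') := @coord_continuous R 1 3 0 k x.
    near=> y; split; apply: ltW; near: y; [exact: N1|exact: N2].
  have {xd'} xdE : `|x - c| = d by apply/eqP; rewrite eq_le xd xd'.
  have [|i] := @rV_norm_attained _ _ (x - c); first by rewrite xdE.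
  rewrite xdE => xi; have x2 : (x 0 i - c 0 i) ^+ 2 = d ^+ 2.
    by rewrite -xi real_normK ?num_real// rV_subE.
  have zk : 0 <= x 0 k - c 0 k <= d.
    rewrite subr_ge0 ck/=; have := rV_norm_coord (x - c) k; rewrite xdE rV_subE.
    by apply: le_trans; exact: ler_norm.
  (* On an outer face some coordinate of [x - c] is [d] in absolute value: for [i = k] the first
     term is [d * (3 * d - 2 * d)], otherwise the sum contains [d ^+ 2]. Hence [N * B x >= 2 * M],
     which bounds the odd part. *)
  have Bd : d ^+ 2 <= B x.
    rewrite BE; have [ik|ik] := eqVneq i k.
      have -> : x 0 k - c 0 k = d.
        by move: x2; rewrite ik => /eqP; rewrite eqf_sqr => /orP[/eqP//|/eqP]; lra.
      by have := sum0 x; nra.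
    rewrite (bigD1 i)//= x2.
    have : 0 <= \sum_(j | (j != k) && (j != i)) (x 0 j - c 0 j) ^+ 2.
      by apply: sumr_ge0 => j _; rewrite sqr_ge0.
    have : 0 <= (x 0 k - c 0 k) * (3 * d - 2 * (x 0 k - c 0 k)).
      by rewrite mulr_ge0//; lra.
    by lra.
  left; have [_ /ler_normlP[u1 u2]] := Hu x xd.
  have [_ /ler_normlP[u3 u4]] := Hu _ (norm_reflect k xd).
  have : 2 * M <= N * B x.
    by rewrite /N mulrAC ler_pdivlMr// ler_wpM2l// mulr_ge0.
  by rewrite /v; lra.
have Ks : K (c + s *: ev k).
  split; first by rewrite addrC addKr (le_trans (rV_norm_scale_ev _ _))// ger0_norm.
  by rewrite comp_addZ eqxx mul1r lerDl.
have sk : (c + s *: ev k) 0 k - c 0 k = s by rewrite comp_addZ eqxx mul1r addrAC subrr add0r.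
have := main _ Ks; rewrite /v BE sk.
rewrite big1 => [|i ik]; last by rewrite comp_addZ eq_sym (negPf ik) mul0r addr0 subrr expr0n.
rewrite reflect_center addr0 subr_le0 => /le_trans; apply.
(* On the axis through [c] the barrier is [s * (3 * d - 2 * s)], at most [s * (3 * d)]. *)
have -> : 6 * M * (s / d) = N * (s * (3 * d)) by rewrite /N; field; rewrite gt_eqF.
by rewrite ler_wpM2l// ler_wpM2l//; lra.
Unshelve. all: by end_near. Qed.

(** The opposite sign is the one-sided bound for [u] composed with the reflection in the mid plane,
    which swaps the two points and preserves the cube. *)
Lemma symdiff_bound u c k (d M s : R) : 0 < d -> 0 <= s <= d ->
  (forall x, `|x - c| <= d -> harmonic_at u x /\ `|u x| <= M) ->
  `|u (c + s *: ev k) - u (c - s *: ev k)| <= 6 * M * (s / d).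
Proof.
move=> d0 sd Hu; apply/ler_normlP; split; last exact: symdiff_le.
have rE' : reflect k (c 0 k) (c - s *: ev k) = c + s *: ev k.
  by rewrite -scaleNr reflect_center scaleNr opprK.
have := @symdiff_le (fun y => u (reflect k (c 0 k) y)) c k d M s d0 sd.
rewrite reflect_center rE' opprB; apply=> x xd.
have [hr Mr] := Hu _ (norm_reflect k xd).
by split => //; exact: harmonic_at_reflect.
Qed.

End SymmetricDifference.

(** * Continuation of zeros by iterated differences *)

Section Continuation.
Variable R : realType.
Implicit Types (u v : 'rV[R]_3 -> R) (x y c p : 'rV[R]_3) (k : 'I_3) (i j : nat).

Definition symdiff k (s : R) u x := u (x + s *: ev k) - u (x - s *: ev k).

Lemma harmonic_at_symdiff k (s : R) u x :
  harmonic_at u (x + s *: ev k) -> harmonic_at u (x - s *: ev k) ->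
  harmonic_at (symdiff k s u) x.
Proof. by move=> h1 h2; apply: harmonic_at_sub; exact: harmonic_at_translate. Qed.

(** [symdiff_bound] needs a cube of radius [d] around the point, so each iteration gives up [d] of
    the radius and gains a factor [6 * (s / d)]. *)
Lemma iter_symdiff_bound u p k (r d M s : R) (j : nat) : 0 < d -> 0 <= s <= d ->
  (forall x, `|x - p| <= r -> harmonic_at u x /\ `|u x| <= M) ->
  forall x, `|x - p| <= r - j%:R * d ->
    harmonic_at (iter j (symdiff k s) u) x /\
    `|iter j (symdiff k s) u x| <= (6 * (s / d)) ^+ j * M.
Proof.
move=> d0 sd Hu; elim: j => [|j IH] x xr.
  by rewrite expr0 mul1r; apply: Hu; move: xr; rewrite mul0r subr0.
have near_x y : `|y - x| <= d -> `|y - p| <= r - j%:R * d.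
  move=> yx; rewrite -[y - p](subrKA x) (le_trans (ler_normD _ _))//.
  by rewrite (le_trans (lerD yx xr))// -natr1; lra.
have ev_s : `|s *: ev k : 'rV[R]_3| <= d.
  by rewrite (le_trans (rV_norm_scale_ev _ _))// ger0_norm; case/andP: sd.
rewrite iterS; split.
  apply: harmonic_at_symdiff; apply: (IH _ _).1; apply: near_x.
    by rewrite addrC addKr.
  by rewrite addrC addKr normrN.
have := @symdiff_bound _ _ x k d _ s d0 sd (fun y yx => IH y (near_x y yx)).
by rewrite /symdiff exprS => /le_trans; apply; rewrite le_eqVlt; apply/orP; left; apply/eqP; ring.
Qed.

(** Row [b i] holds the [i]-th differences of row [b 0]. The initial zeros fill the corner
    [i + j <= n], row [n] is at most [e], and rebuilding the next column by
    [b i j.+1 = b i j + b i.+1 j] at most doubles the bound. *)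
Lemma difference_table_bound (b : nat -> nat -> R) (n : nat) (e : R) : 0 <= e ->
  (forall i j, b i.+1 j = b i j.+1 - b i j) ->
  (forall j, (j <= n)%N -> b 0%N j = 0) ->
  (forall j, (j <= n.*2)%N -> `|b n j| <= e) ->
  forall j, (j <= n.*2)%N -> `|b 0%N j| <= 2 ^+ j * e.
Proof.
move=> e0 bS b0 bn.
have b_eq0 i j : (i + j <= n)%N -> b i j = 0.
  elim: i j => [|i IH] j ijn; first exact: b0.
  by rewrite bS !IH ?subrr//; lia.
suff H j : (j <= n.*2)%N -> forall i, (i <= n)%N -> `|b i j| <= 2 ^+ j * e.
  by move=> j jn; exact: H.
elim: j => [_ i ni|j IH jn i].
  by rewrite b_eq0 ?addn0// normr0 mulr_ge0.
rewrite leq_eqVlt => /orP[/eqP->|ni].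
  by rewrite (le_trans (bn _ jn))// ler_peMl// exprn_ege1// ler1n.
have -> : b i j.+1 = b i j + b i.+1 j by rewrite bS; ring.
rewrite (le_trans (ler_normD _ _))// exprS.
have := IH (ltnW jn) i (ltnW ni); have := IH (ltnW jn) i.+1 ni; lra.
Qed.

(* With step L / n the n-th differences are at most (6 L / r)^n M, and summing
   the difference table over 2 n steps costs a factor 4^n; since 24 L / r <= 1/2
   the resulting bound tends to 0 with n. *)
Lemma harmonic_continuation u p k (r M L : R) x : 0 < L -> 48 * L <= r ->
  (forall y, `|y - p| <= r -> harmonic_at u y /\ `|u y| <= M) ->
  `|x - p| <= r / 4 ->
  (forall t, 0 <= t <= L -> u (x - t *: ev k) = 0) ->
  u (x + L *: ev k) = 0.
Proof.
move=> L0 Lr Hu xp u0.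
have r0 : 0 < r by lra.
have M0 : 0 <= M.
  by have [_] := Hu p ltac:(by rewrite subrr normr0 ltW); apply: le_trans.
suff H n : `|u (x + L *: ev k)| <= 2^-1 ^+ n.+1 * M.
  apply/eqP; rewrite -normr_le0; apply/ler_addgt0Pl => e e0; rewrite addr0.
  have C : (2^-1 : R) ^+ n * M @[n --> \oo] --> 0 * M.
    apply: cvgM; last exact: cvg_cst.
    by apply: cvg_expr; rewrite ger0_norm ?invr_ge0// invf_lt1 ?ltr1n.
  move: C; rewrite mul0r => /(cvgr_le _)/(_ _ e0) [N _ /(_ N.+1)] /= HN.
  by rewrite (le_trans (H N))// HN.
(* The samples have spacing [2 * s], so [n.+1.*2] steps lead from [x - L *: ev k] to
   [x + L *: ev k], and the first half lies where [u] is known to vanish. With [d] below, [n.+1]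
   differences use up [r / 2] of the radius. *)
pose s := L / (2 * n.+1%:R).
pose d := r / (2 * n.+1%:R).
have n0 : 0 < 2 * n.+1%:R :> R by rewrite mulr_gt0.
have d0 : 0 < d by rewrite divr_gt0.
have s0 : 0 <= s by rewrite divr_ge0// ltW.
have sd : s <= d by rewrite ler_pM2r ?invr_gt0//; lra.
have sn : s * n.+1%:R = L / 2 by rewrite /s; field; rewrite gt_eqF.
pose y0 := x - L *: ev k.
(* An [i]-fold symmetric difference is centred, hence the offset [i]: it turns [symdiff] into the
   forward difference in [j]. *)
pose b i j := iter i (symdiff k s) u (y0 + ((j.*2 + i)%:R * s) *: ev k).
have n2 m : (m <= n.+1 * 5)%N -> 0 <= m%:R * s <= 5 / 2 * L.
  move=> mn; rewrite mulr_ge0//=.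
  have -> : 5 / 2 * L = (n.+1 * 5)%:R * s.
    have -> : (n.+1 * 5)%:R * s = 5 * (s * n.+1%:R) by rewrite natrM; ring.
    by rewrite sn; lra.
  by rewrite ler_wpM2r// ler_nat.
have bM j : (j <= n.+1.*2)%N -> `|b n.+1 j| <= (6 * (s / d)) ^+ n.+1 * M.
  have sds : 0 <= s <= d by rewrite s0.
  move=> jn; suff yr : `|y0 + ((j.*2 + n.+1)%:R * s) *: ev k - p| <= r - n.+1%:R * d.
    by case: (iter_symdiff_bound k d0 sds Hu yr).
  have -> : r - n.+1%:R * d = r / 2 by rewrite /d; field; rewrite gt_eqF.
  have /n2/andP[m0 mL] : (j.*2 + n.+1 <= n.+1 * 5)%N by lia.
  set t := _%:R * s in m0 mL *.
  have -> : y0 + t *: ev k - p = (x - p) + (t - L) *: ev k.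
    by rewrite /y0 scalerBl; apply/rowP => l; rewrite !mxE; ring.
  rewrite (le_trans (ler_normD _ _))//.
  have := rV_norm_scale_ev (t - L) k; have : `|t - L| <= 3 / 2 * L by rewrite ler_norml; lra.
  by lra.
have bS i j : b i.+1 j = b i j.+1 - b i j.
  have -> : b i.+1 j = iter i (symdiff k s) u (y0 + ((j.*2 + i.+1)%:R * s) *: ev k + s *: ev k)
    - iter i (symdiff k s) u (y0 + ((j.*2 + i.+1)%:R * s) *: ev k - s *: ev k) by [].
  have E1 : (j.*2 + i.+1)%:R * s + s = (j.+1.*2 + i)%:R * s.
    by rewrite (_ : j.+1.*2 + i = (j.*2 + i).+2)%N ?addnS -?natr1; [ring|lia].
  have E2 : (j.*2 + i.+1)%:R * s - s = (j.*2 + i)%:R * s by rewrite addnS -natr1; ring.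
  by rewrite -!addrA -scalerDl -scalerBl E1 E2 /b /y0 -!addrA.
have b0 j : (j <= n.+1)%N -> b 0%N j = 0.
  move=> jn; rewrite /b /= addn0.
  have tL : j.*2%:R * s <= L.
    rewrite -muln2 natrM mulrAC [j%:R * s]mulrC.
    have : s * j%:R <= s * n.+1%:R by rewrite ler_wpM2l// ler_nat.
    by rewrite sn; lra.
  have := u0 (L - j.*2%:R * s); rewrite scalerBl opprB addrA /y0 addrAC; apply.
  by have : 0 <= j.*2%:R * s by [rewrite mulr_ge0|]; lra.
have e0 : 0 <= (6 * (s / d)) ^+ n.+1 * M.
  by rewrite mulr_ge0// exprn_ge0// mulr_ge0// divr_ge0// ltW.
have := difference_table_bound e0 bS b0 bM (leqnn _).
rewrite {1}/b /= addn0.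
have -> : y0 + (n.+1.*2.*2%:R * s) *: ev k = x + L *: ev k.
  have -> : n.+1.*2.*2%:R * s = 2 * L.
    have -> : n.+1.*2.*2%:R * s = 4 * (s * n.+1%:R) by rewrite -!muln2 !natrM; ring.
    by rewrite sn; lra.
  by rewrite /y0 -addrA -scaleNr -scalerDl; congr (_ + _ *: _); ring.
move=> /le_trans; apply; rewrite mulrA ler_wpM2r// -muln2 mulnC exprM -exprMn.
have -> : s / d = L / r by rewrite /s /d; field; rewrite !gt_eqF.
have q48 : L / r <= 48^-1 by rewrite ler_pdivrMr//; lra.
have q0 : 0 <= L / r by rewrite divr_ge0 ?ltW.
have -> : 2 ^+ 2 * (6 * (L / r)) = 24 * (L / r) by ring.
by apply: lerXn2r; rewrite ?nnegrE; lra.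
Qed.

End Continuation.

(** * Primitives, uniformity along segments, and vertical projection *)

Section Potential.
Variable R : realType.
Implicit Types (x y z p : 'rV[R]_3) (i j k : 'I_3).

Lemma continuous_primitive (f : R -> R) (a b t0 : R) : a < b ->
  (forall t, a <= t <= b -> {for t, continuous f}) ->
  exists P : R -> R, P t0 = 0 /\ forall t, a < t < b -> is_derive t 1 P (f t).
Proof.
move=> ab cf.
pose F (s : R) := \int[lebesgue_measure]_(t in `[a, s]) f t.
exists (fun s => F s - F t0); split => [|t /andP[at' tb]]; first by rewrite subrr.
have fi : lebesgue_measure.-integrable `[a, b] (EFin \o f).
  apply: continuous_compact_integrable; first exact: segment_compact.
  by apply: continuous_in_subspaceT => t1; rewrite inE/= in_itv/=; exact: cf.
have ct : {for t, continuous f} by apply: cf; rewrite !ltW.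
have [dF FE] := continuous_FTC1_closed tb fi at' ct.
have D : is_derive t 1 F (f t) by apply: DeriveDef => //; rewrite -derive1E.
by rewrite -[f t]subr0; apply: is_deriveB.
Qed.

Lemma is_derive_line (f : 'rV[R]_3 -> R) x i (t a : R) :
  is_derive (0 : R) 1 (fun s => f (x + t *: ev i + s *: ev i)) a ->
  is_derive t 1 (fun s => f (x + s *: ev i)) a.
Proof.
move=> D; have := @is_derive_shift _ (fun s => f (x + t *: ev i + s *: ev i)) t (- t) a.
rewrite subrr => /(_ D); congr is_derive; apply/funext => s.
by rewrite -addrA -scalerDl; congr (f (_ + _ *: _)); ring.
Qed.

(** Tube lemma: compactness of the segment makes the neighbourhood of [z] independent of the height
    [t]. It replaces differentiation and continuity theorems under the integral. *)
Lemma near_segment (F : 'rV[R]_3 -> R) z k (a b e : R) : 0 < e ->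
  (forall t, a <= t <= b -> {for z + t *: ev k, continuous F}) ->
  \forall z' \near z, forall t, a <= t <= b ->
    `|F (z' + t *: ev k) - F (z + t *: ev k)| < e.
Proof.
move=> e0 cF.
have /compact_near_coveringP := @segment_compact R a b.
move=> /(_ _ (nbhs z) (fun z' t => `|F (z' + t *: ev k) - F (z + t *: ev k)| < e)).
move=> H; have {}H : \forall z' \near z, `[a, b] `<=` (fun t => `|F (z' + t *: ev k) - F (z + t *: ev k)| < e).
  apply: H => t /=; rewrite in_itv/= => tab.
  have C : (w.2 + w.1 *: ev k) @[w --> (t, z)] --> z + t *: ev k.
    by apply: cvgD; [exact: cvg_snd|apply: cvgZr_tmp; exact: cvg_fst].
  have C' : (z + w.1 *: ev k) @[w --> (t, z)] --> z + t *: ev k.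
    by apply: cvgD; [exact: cvg_cst|apply: cvgZr_tmp; exact: cvg_fst].
  have e2 : 0 < e / 2 by rewrite divr_gt0.
  have := cvg_comp _ _ C (cF t tab) => /cvgrPdist_lt/(_ _ e2) N1.
  have := cvg_comp _ _ C' (cF t tab) => /cvgrPdist_lt/(_ _ e2) N2.
  near=> w.
  have w1 : `|F (z + t *: ev k) - F (w.2 + w.1 *: ev k)| < e / 2 by near: w; exact: N1.
  have w2 : `|F (z + t *: ev k) - F (z + w.1 *: ev k)| < e / 2 by near: w; exact: N2.
  move: w1 w2; rewrite !ltr_norml; lra.
by apply: filterS H => z' Hz' t tab; apply: Hz'; rewrite /= in_itv.
Unshelve. all: by end_near. Qed.

(** The projection along [ev k] onto the coordinate plane through [p]. *)
Definition foot k p x := x - (x 0 k - p 0 k) *: ev k.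

Lemma foot_continuous k p : continuous (foot k p).
Proof.
move=> x; apply: (@continuousB _ _ _ id); first exact: cvg_id.
apply: (@continuousZ _ _ _ (fun y : 'rV[R]_3 => y 0 k - p 0 k) (fun=> ev k)); last exact: cst_continuous.
apply: (@continuousB _ _ _ (fun y : 'rV[R]_3 => y 0 k) (fun=> p 0 k)); last exact: cst_continuous.
exact: coord_continuous.
Qed.

Lemma footE k p x j : (foot k p x) 0 j = if j == k then p 0 k else x 0 j.
Proof.
by rewrite !mxE/=; have [->|_] := eqVneq j k; rewrite /= ?mulr1 ?mulr0 ?subr0//; ring.
Qed.

Lemma foot_norm k p x (r : R) : `|x - p| <= r -> `|foot k p x - p| <= r.
Proof.
move=> xr; have r0 : 0 <= r by exact: le_trans xr.
apply/rV_norm_le => // j; rewrite rV_subE footE.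
have [->|jk] := eqVneq j k; first by rewrite subrr normr0.
by move/(rV_norm_le _ r0)/(_ j): xr; rewrite rV_subE.
Qed.

Lemma footK k p x : foot k p x + (x 0 k - p 0 k) *: ev k = x.
Proof. by rewrite subrK. Qed.

Lemma foot_addZ k p x i (s : R) :
  foot k p (x + s *: ev i) = foot k p x + (if i == k then 0 else s) *: ev i.
Proof.
apply/rowP => j; rewrite footE !comp_addZ footE.
have [->|jk] := eqVneq j k; first by case: (i == k); rewrite ?mulr0 ?mul0r addr0.
by have [->|ik//] := eqVneq i k; rewrite (eq_sym k) (negPf jk) !mul0r.
Qed.

(** A cube is the product of its base and its range of heights. *)
Lemma vertical_norm k p z (t r : R) : z 0 k = p 0 k -> `|z - p| <= r -> `|t| <= r ->
  `|z + t *: ev k - p| <= r.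
Proof.
move=> zk zr tr; have r0 : 0 <= r by exact: le_trans zr.
apply/rV_norm_le => // j; rewrite rV_subE comp_addZ.
have [<-|jk] := eqVneq k j; first by rewrite zk mul1r addrAC subrr add0r.
by rewrite mul0r addr0; move/(rV_norm_le _ r0)/(_ j): zr; rewrite rV_subE.
Qed.

End Potential.

(** * The vertical primitive of a divergence-free and curl-free field *)

Section VerticalPrimitive.
(** [D i j] is the derivative of [G j] in direction [i]. The field is controlled up to radius [rho],
    primitives start at height [- tau], and the potential is studied within [delta] of [p]. *)
Variables (R : realType) (p : 'rV[R]_3) (k : 'I_3) (rho tau delta : R).
Variables (G : 'I_3 -> 'rV[R]_3 -> R) (D : 'I_3 -> 'I_3 -> 'rV[R]_3 -> R).
Implicit Types (x y z : 'rV[R]_3) (i j : 'I_3).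
Hypotheses (delta0 : 0 < delta) (delta_tau : delta <= tau) (tau_rho : tau < rho).
Hypothesis cG : forall j x, `|x - p| <= rho -> {for x, continuous (G j)}.
Hypothesis cD : forall i j x, `|x - p| <= rho -> {for x, continuous (D i j)}.
Hypothesis dG : forall i j x, `|x - p| <= rho ->
  is_derive (0 : R) 1 (fun t => G j (x + t *: ev i)) (D i j x).
Hypothesis D_sym : forall i j x, `|x - p| <= rho -> D i j x = D j i x.
Hypothesis D_trace : forall x, `|x - p| <= rho -> \sum_i D i i x = 0.
Hypothesis G_bottom : forall j z, `|z - p| < delta -> z 0 k = p 0 k ->
  G j (z + (- tau) *: ev k) = 0.

(** The conditions on [z] stand inside the existential, so that choice yields a function for every
    [z], arbitrary off the base. *)
Let vprim_ex z : exists P : R -> R, `|z - p| <= rho -> z 0 k = p 0 k ->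
  P (- tau) = 0 /\
  forall t : R, `|t| < rho -> is_derive t 1 P (G k (z + t *: ev k)).
Proof.
have [zr|?] := pselect (`|z - p| <= rho); last by exists (fun=> 0).
have [zk|?] := pselect (z 0 k = p 0 k); last by exists (fun=> 0).
have [||P [P0 dP]] := @continuous_primitive R (fun t => G k (z + t *: ev k)) (- rho) rho (- tau).
- by move: delta0 delta_tau tau_rho; lra.
- move=> t; rewrite -ler_norml => tr.
  apply: (@continuous_comp _ _ _ (fun t : R => z + t *: ev k) (G k)); first exact: line_continuous.
  by apply: cG; exact: vertical_norm.
by exists P => _ _; split => // t; rewrite ltr_norml; exact: dP.
Qed.

Let vprim z : R -> R := projT1 (cid (vprim_ex z)).

Let vprim_bottom z : `|z - p| <= rho -> z 0 k = p 0 k -> vprim z (- tau) = 0.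
Proof. by rewrite /vprim; case: cid => P /= H zr zk; case: (H zr zk). Qed.

Let is_derive_vprim z (t : R) : `|z - p| <= rho -> z 0 k = p 0 k -> `|t| < rho ->
  is_derive t 1 (vprim z) (G k (z + t *: ev k)).
Proof. by rewrite /vprim; case: cid => P /= H zr zk; case: (H zr zk) => _; apply. Qed.

Definition vpotential x := vprim (foot k p x) (x 0 k - p 0 k).

Let foot_k x : foot k p x 0 k = p 0 k.
Proof. by rewrite footE eqxx. Qed.

Let delta_rho : delta < rho. Proof. exact: le_lt_trans tau_rho. Qed.

Let foot_rho x : `|x - p| < delta -> `|foot k p x - p| <= rho.
Proof. by move=> xd; apply: foot_norm; rewrite ltW// (lt_trans xd). Qed.

Let height_lt x : `|x - p| < delta -> `|x 0 k - p 0 k| < delta.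
Proof. by move=> xd; rewrite -rV_subE (le_lt_trans (rV_norm_coord _ _)). Qed.

Let near_ball x : `|x - p| < delta -> \forall y \near x, `|y - p| < delta.
Proof.
move=> xd; have : {for x, continuous (fun y => `|y - p|)}.
  apply: (@continuous_comp _ _ _ (fun y => y - p) Num.norm); last exact: norm_continuous.
  by apply: (@continuousB _ _ _ id); [exact: cvg_id|exact: cst_continuous].
by move=> /(cvgr_lt _)/(_ _ xd).
Qed.

Lemma vpotential_eq0 x : `|x - p| < delta ->
  (forall t : R, 0 <= t -> G k (x - t *: ev k) = 0) -> vpotential x = 0.
Proof.
move=> xd Gx; rewrite /vpotential.
have t0 := height_lt xd; set t0' := x 0 k - p 0 k in t0 *.
have /andP[t1 t2] : - delta < t0' < delta by rewrite -ltr_norml.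
suff : `|vprim (foot k p x) t0' - vprim (foot k p x) (- tau)| <= 0 * (t0' - - tau).
  by rewrite vprim_bottom ?foot_rho// subr0 mul0r normr_le0 => /eqP.
apply: (@MVT_norm _ _ (fun=> 0)) => [|t /andP[t3 t4]|*]; last by rewrite normr0.
  by move: delta_tau; lra.
have tr : `|t| < rho by rewrite ltr_norml; move: delta_tau tau_rho; lra.
have := is_derive_vprim (foot_rho xd) (foot_k x) tr.
suff -> : G k (foot k p x + t *: ev k) = 0 by [].
have -> : foot k p x + t *: ev k = x - (t0' - t) *: ev k.
  by rewrite scalerBl opprB addrA [RHS]addrAC.
by apply: Gx; lra.
Qed.

(* D_sym lets d_i act under the vertical primitive: the integrand d_i G_k is
   d_k G_i, whose primitive from the bottom is G_i. *)
Let lateral_derive x i : i != k -> `|x - p| < delta ->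
  is_derive (0 : R) 1 (fun s => vpotential (x + s *: ev i)) (G i x).
Proof.
move=> ik xd; pose z : 'rV[R]_3 := foot k p x; pose t0 : R := x 0 k - p 0 k.
have zr : `|z - p| <= rho by exact: foot_rho.
have /andP[t1 t2] : - delta < t0 < delta by rewrite -ltr_norml; exact: height_lt.
have zd : `|z - p| < delta.
  by apply: le_lt_trans xd; exact: foot_norm.
have zt (t : R) : - tau <= t <= t0 -> `|z + t *: ev k - p| <= rho.
  move=> /andP[t3 t4]; apply: vertical_norm => //; first exact: foot_k.
  by rewrite ler_norml; move: delta_tau tau_rho; lra.
apply/is_derive_normP => e e0.
have T0 : 0 < t0 + tau by move: delta_tau; lra.
have e1 : 0 < e / (t0 + tau) by rewrite divr_gt0.
have NS := near_segment e1 (fun t ht => @cD i k _ (zt t ht)).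
have L0 : (fun s : R => z + s *: ev i) @ (0 : R) --> z.
  by have := @line_continuous _ z i 0; rewrite /continuous_at scale0r addr0.
have N1 : \forall s \near (0 : R), `|z + s *: ev i - p| < delta /\
   forall t, - tau <= t <= t0 -> `|D i k (z + s *: ev i + t *: ev k) - D i k (z + t *: ev k)| < e / (t0 + tau).
  near=> s; split; near: s; [exact: L0 _ (near_ball zd)|exact: L0 _ NS].
move: N1 => /nbhs_ballP[r /= r0 Hr].
apply/nbhs_ballP; exists r => //= s; rewrite /ball/= sub0r normrN => sr.
have {}Hr r' : `|r'| <= `|s| -> `|z + r' *: ev i - p| < delta /\
   forall t, - tau <= t <= t0 -> `|D i k (z + r' *: ev i + t *: ev k) - D i k (z + t *: ev k)| < e / (t0 + tau).
  by move=> rs; apply: Hr; rewrite /ball/= sub0r normrN (le_lt_trans rs).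
rewrite add0r scale0r addr0 /vpotential foot_addZ (negPf ik) comp_addZ (negPf ik) mul0r addr0.
rewrite -/z -/t0; pose z' : 'rV[R]_3 := z + s *: ev i; rewrite -/z'.
have zk : z 0 k = p 0 k by exact: foot_k.
have z'k : z' 0 k = p 0 k by rewrite comp_addZ (negPf ik) mul0r addr0.
have z'd : `|z' - p| < delta by case: (Hr s (lexx _)).
have z'r : `|z' - p| <= rho by rewrite ltW// (lt_trans z'd).
have xE : x = z + t0 *: ev k by rewrite footK.
(* At [t0] this is the first-order error to be bounded, and it vanishes at the bottom. Its
   [t]-derivative is the first-order error of [G k] in direction [i], at most
   [e / (t0 + tau) * |s|], over a segment of length [t0 + tau]. *)
pose phi t := vprim z' t - vprim z t - s * G i (z + t *: ev k).
have phib : phi (- tau) = 0.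
  by rewrite /phi !vprim_bottom// G_bottom// mulr0 !subr0.
have -> : vprim z' t0 - vprim z t0 - G i x * s = phi t0 - phi (- tau).
  by rewrite phib subr0 /phi -xE mulrC.
have -> : e * `|s| = (e / (t0 + tau) * `|s|) * (t0 - (- tau)).
  by rewrite opprK; field; rewrite gt_eqF.
apply: (@MVT_norm R phi (fun t => G k (z' + t *: ev k) - G k (z + t *: ev k) - s * D k i (z + t *: ev k))).
- by move: T0; lra.
- move=> t tt; have tr : `|t| < rho.
    by rewrite ltr_norml; move: tt delta_tau tau_rho; lra.
  apply: is_derive_subZ.
    by apply: is_deriveB; exact: is_derive_vprim.
  by apply: (@is_derive_line _ (G i) z k t); exact: (@dG k i _ (zt t tt)).
move=> t tt; rewrite D_sym; last exact: zt.
pose y := z + t *: ev k.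
(* The derivative of this remainder is a variation of [D i k], which [near_segment] has bounded
   uniformly in the height. *)
pose g r' := G k (y + r' *: ev i) - D i k y * r'.
have -> : G k (z' + t *: ev k) - G k (z + t *: ev k) - s * D i k (z + t *: ev k) = g (0 + s) - g 0.
  by rewrite /g add0r scale0r mulr0 subr0 addr0 /y /z' [z + _ + t *: _]addrAC; ring.
apply: (@MVT_norm_sym R g (fun r' => D i k (y + r' *: ev i) - D i k y)) => r' rs.
  have I : is_derive (r' : R) 1 (id : R -> R) 1 by exact: is_derive_id.
  rewrite add0r; suff H : is_derive r' 1 (fun t => G k (y + t *: ev i)) (D i k (y + r' *: ev i)).
    by have := is_derive_subZ (D i k y) H I; rewrite mulr1.
  have yE : y + r' *: ev i - p = z + r' *: ev i + t *: ev k - p by rewrite /y [X in X - p]addrAC.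
  apply: (@is_derive_line _ (G k) y i r'); apply: dG; rewrite yE; apply: vertical_norm.
  - by rewrite comp_addZ (negPf ik) mul0r addr0.
  - by rewrite ltW// (lt_trans (Hr _ rs).1).
  - by rewrite ler_norml; move: tt delta_tau tau_rho; lra.
have [_ /(_ t tt)] := Hr _ rs.
by rewrite -/y (_ : z + r' *: ev i + t *: ev k = y + r' *: ev i) 1?addrAC// => /ltW.
Unshelve. all: by end_near. Qed.

Lemma is_derive_vpotential x i : `|x - p| < delta ->
  is_derive (0 : R) 1 (fun s => vpotential (x + s *: ev i)) (G i x).
Proof.
move=> xd; have [->|] := eqVneq i k; last by move/lateral_derive; apply.
have -> : (fun s => vpotential (x + s *: ev k)) =
    (fun s => vprim (foot k p x) (s + (x 0 k - p 0 k))).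
  apply/funext => s; rewrite /vpotential foot_addZ eqxx scale0r addr0.
  by rewrite comp_addZ eqxx mul1r; congr vprim; ring.
apply: is_derive_shift; rewrite add0r.
have := is_derive_vprim (foot_rho xd) (foot_k x) (lt_trans (height_lt xd) delta_rho).
by rewrite footK.
Qed.

(** Derivatives along coordinate lines do not give joint continuity. The height varies on the fixed
    line above [z], where the primitive is continuous; the foot varies with an integrand that is
    uniformly close over a length at most [2 * tau]. *)
Lemma vpotential_continuous x : `|x - p| < delta -> {for x, continuous vpotential}.
Proof.
move=> xd; pose z : 'rV[R]_3 := foot k p x; pose t0 : R := x 0 k - p 0 k.
have tau0 : 0 < tau by exact: lt_le_trans delta_tau.
have zr : `|z - p| <= rho by exact: foot_rho.
have zt (t : R) : - tau <= t <= tau -> `|z + t *: ev k - p| <= rho.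
  move=> tt; apply: vertical_norm => //; first exact: foot_k.
  by rewrite ler_norml; move: tau_rho; lra.
apply/(@cvgrPdist_le _ _ _ (nbhs x)) => e e0.
have e2 : 0 < e / 2 by rewrite divr_gt0.
have e1 : 0 < e / 2 / (2 * tau) by rewrite divr_gt0// mulr_gt0.
have NS := near_segment e1 (fun t ht => @cG k _ (zt t ht)).
have C1 : {for x, continuous (fun y : 'rV[R]_3 => vprim z (y 0 k - p 0 k))}.
  apply: (@continuous_comp _ _ _ (fun y : 'rV[R]_3 => y 0 k - p 0 k) (vprim z)).
    apply: (@continuousB _ _ _ (fun y : 'rV[R]_3 => y 0 k) (fun=> p 0 k)); last exact: cst_continuous.
    exact: coord_continuous.
  apply: is_derive_continuous; apply: is_derive_vprim => //; first exact: foot_k.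
  by rewrite (lt_trans (height_lt xd)).
have N1 := foot_continuous NS.
have /cvgrPdist_le/(_ _ e2) N2 := C1.
have N3 := near_ball xd.
near=> y.
have yd : `|y - p| < delta by near: y; exact: N3.
have y2 : `|vprim z (x 0 k - p 0 k) - vprim z (y 0 k - p 0 k)| <= e / 2 by near: y; exact: N2.
have y1 : forall t, - tau <= t <= tau -> `|G k (foot k p y + t *: ev k) - G k (z + t *: ev k)| < e / 2 / (2 * tau).
  by near: y; exact: N1.
rewrite /vpotential -/z; pose z' : 'rV[R]_3 := foot k p y; pose t' : R := y 0 k - p 0 k.
rewrite -/z' -/t' in y1 y2 *.
have /andP[t1 t2] : - delta < t' < delta by rewrite -ltr_norml; exact: height_lt.
have z'r : `|z' - p| <= rho by exact: foot_rho.
have := @MVT_norm R (fun t => vprim z' t - vprim z t) (fun t => G k (z' + t *: ev k) - G k (z + t *: ev k)) (- tau) t' (e / 2 / (2 * tau)).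
rewrite !vprim_bottom ?foot_k// !subr0 => H.
have {}H : `|vprim z' t' - vprim z t'| <= e / 2.
  apply: le_trans (H _ _ _) _.
  - by move: delta_tau; lra.
  - move=> t tt; have tr : `|t| < rho.
      by rewrite ltr_norml; move: tt delta_tau tau_rho; lra.
    by apply: is_deriveB; apply: is_derive_vprim => //; exact: foot_k.
  - by move=> t tt; apply/ltW/y1; move: tt delta_tau; lra.
  - have {2}-> : e / 2 = e / 2 / (2 * tau) * (2 * tau) by field; rewrite gt_eqF.
    by rewrite (ler_wpM2l (ltW e1))//; move: delta_tau; lra.
move: y2 H; rewrite !ler_norml; lra.
Unshelve. all: by end_near. Qed.

(** The gradient is [G], so the pure second derivatives are the diagonal entries [D i i], of sum
    zero. *)
Lemma vpotential_harmonic x : `|x - p| < delta -> harmonic_at vpotential x.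
Proof.
move=> xd; split; first exact: vpotential_continuous.
exists (fun i t => G i (x + t *: ev i)), (fun i => D i i x); split.
- move=> i; have := @line_continuous _ x i 0.
  rewrite /continuous_at scale0r addr0 => /(_ _ (near_ball xd)) N.
  near=> t; apply: (@is_derive_line _ vpotential); apply: is_derive_vpotential.
  by near: t; exact: N.
- by move=> i; apply: dG; rewrite ltW// (lt_trans xd).
- by apply: D_trace; rewrite ltW// (lt_trans xd).
Unshelve. all: by end_near. Qed.

Lemma harmonic_potential : exists h : 'rV[R]_3 -> R, forall x, `|x - p| < delta ->
  [/\ harmonic_at h x,
      forall i, is_derive (0 : R) 1 (fun s => h (x + s *: ev i)) (G i x)
    & (forall t : R, 0 <= t -> G k (x - t *: ev k) = 0) -> h x = 0].
Proof.
exists vpotential => x xd; split; first exact: vpotential_harmonic.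
- by move=> i; exact: is_derive_vpotential.
- exact: vpotential_eq0.
Qed.

End VerticalPrimitive.

(** * Linear algebra of a tangent plane and a transverse axis *)

Section LinearAlgebra.
Variable R : realType.

(** [n] is normal to the rows of [M]; an axis with [n k 0 != 0] is transverse to them, and
    [row_mx B n] inverts [col_mx M (ev k)]. Thus [B] projects along [ev k] to tangential
    coordinates. *)
Lemma row_free_frame (M : 'M[R]_(2, 3)) : row_free M ->
  exists (k : 'I_3) (B : 'M[R]_(3, 2)) (n : 'cV[R]_3),
  [/\ M *m B = 1%:M, ev k *m B = 0, n k 0 = 1 & B *m M + n *m ev k = 1%:M].
Proof.
move=> fM.
have [n0 n0M n0_neq0] : exists2 n : 'cV[R]_3, M *m n = 0 & n != 0.
  have : kermx M^T != 0.
    rewrite -mxrank_eq0 mxrank_ker mxrank_tr.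
    by move: fM; rewrite /row_free => /eqP ->.
  move=> /rowV0Pn[v /sub_kermxP vM v0]; exists v^T; last by rewrite trmx_eq0.
  by apply: trmx_inj; rewrite trmx_mul trmxK vM trmx0.
have [k nk] : exists k, n0 k 0 != 0.
  apply/existsP; apply: contraNT n0_neq0; rewrite negb_exists => /forallP n0E.
  by apply/eqP/colP => i; rewrite mxE; apply/eqP; have := n0E i; rewrite negbK.
pose n := (n0 k 0)^-1 *: n0.
have Mn : M *m n = 0 by rewrite /n -scalemxAr n0M scaler0.
have nk1 : n k 0 = 1 by rewrite mxE mulVf.
have evk m (A : 'M[R]_(3, m)) : ev k *m A = row k A by rewrite rowE.
have kn : ev k *m n = 1%:M.
  by rewrite evk; apply/matrixP => i j; rewrite !ord1 mxE nk1 !mxE.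
(* The first factor is fixed by left multiplication by [M] and killed by left multiplication by
   [ev k], so it corrects the right inverse [pinvmx M]. *)
pose B := (1%:M - n *m ev k) *m pinvmx M.
have MB : M *m B = 1%:M.
  by rewrite /B mulmxA mulmxBr mulmx1 (mulmxA M n) Mn mul0mx subr0 mulmxVp.
have kB : ev k *m B = 0.
  by rewrite /B mulmxA mulmxBr mulmx1 (mulmxA _ n) kn mul1mx subrr mul0mx.
exists k, B, n; split => //.
have E : col_mx M (ev k) *m row_mx B n = (1%:M : 'M[R]_(2 + 1)).
  by rewrite mul_col_row MB Mn kB kn -scalar_mx_block.
by have := mulmx1C E; rewrite mul_row_col.
Qed.

(** Killing the rows of [M] leaves [J = n *m r] of rank at most one. Symmetry makes it [r 0 k] times
    $n n^T$, whose trace is [r 0 k] times a positive sum of squares. *)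
Lemma symmetric_traceless_eq0 (M : 'M[R]_(2, 3)) (J : 'M[R]_3) : row_free M ->
  M *m J = 0 -> J^T = J -> \tr J = 0 -> J = 0.
Proof.
move=> /row_free_frame[k [B [n [MB kB nk E]]]] MJ Js Jt.
pose r := ev k *m J.
have JE : J = n *m r.
  by rewrite -[LHS]mul1mx -E mulmxDl -!mulmxA MJ mulmx0 add0r.
have JnE i j : J i j = n i 0 * r 0 j by rewrite {1}JE mxE big_ord1.
have rE j : r 0 j = n j 0 * r 0 k.
  rewrite -JnE /r /ev -rowE mxE.
  by have := congr1 (fun A : 'M[R]_3 => A k j) Js; rewrite mxE.
pose N := \sum_i n i 0 ^+ 2.
have N0 : 0 < N.
  rewrite /N (bigD1 k)//= nk expr1n ltr_pwDl//.
  by apply: sumr_ge0 => i _; rewrite sqr_ge0.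
have : N * r 0 k = 0.
  by rewrite -[RHS]Jt /mxtrace mulr_suml; apply: eq_bigr => i _; rewrite JnE (rE i) expr2 mulrA.
move=> /eqP; rewrite mulf_eq0 gt_eqF//= => /eqP rk.
by apply/matrixP => i j; rewrite JnE rE rk !mulr0 mxE.
Qed.

End LinearAlgebra.

(** * Directional derivatives in coordinates *)

Section Differential.
Variables (R : realType) (n m : nat).
Implicit Types (f : 'rV[R]_n -> 'rV[R]_m) (x v : 'rV[R]_n).

Lemma is_derive_line_coord f x v (j : 'I_m) : differentiable f x ->
  is_derive (0 : R) 1 (fun t => f (x + t *: v) 0 j) ('D_v f x 0 j).
Proof.
move=> df; have C : h^-1 *: ((f \o shift x) (h *: v) - f x) @[h --> 0^'] --> 'D_v f x.
  exact: diff_derivable.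
have {}C : (fun h : R => (h^-1 *: ((f \o shift x) (h *: v) - f x)) 0 j) @ 0^' --> 'D_v f x 0 j.
  exact: (cvg_comp _ _ C (@coord_continuous R 1 m 0 j _)).
pose g (t : R) := f (x + t *: v) 0 j.
have E : (fun h : R => h^-1 *: ((g \o shift 0) (h *: 1) - g 0)) =
    (fun h : R => (h^-1 *: ((f \o shift x) (h *: v) - f x)) 0 j).
  apply/funext => h; rewrite /g !mxE /= addr0 scale0r addr0 /GRing.scale/= mulr1.
  by rewrite [x + _]addrC.
rewrite -E in C.
by apply: DeriveDef; [apply/cvg_ex; exists ('D_v f x 0 j)|exact: cvg_lim].
Qed.

Lemma derive_coord f x v (j : 'I_m) : differentiable f x ->
  'D_v f x 0 j = \sum_i v 0 i * pderiv f i x 0 j.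
Proof.
move=> df; rewrite deriveE// {1}(row_sum_delta v) linear_sum summxE.
by apply: eq_bigr => i _; rewrite linearZ mxE /pderiv deriveE.
Qed.

End Differential.

(** * Strict differentiability of $C^1$ maps *)

Section StrictDifferentiability.
Variables (R : realType) (n m : nat).

(** The mean value theorem on the segment from [q'] to [q], along which each of the [n] partial
    derivatives is within [e / n.+1%:R] of its value at [q0]. Allowing both endpoints to vary is
    what the contraction argument needs. *)
Lemma C1_strict_differentiable (V : set 'rV[R]_n) (f : 'rV[R]_n -> 'rV[R]_m)
    (q0 : 'rV[R]_n) (e : R) : open V -> C1_on V f -> V q0 -> 0 < e ->
  exists2 eta : R, 0 < eta & forall q q', `|q - q0| < eta -> `|q' - q0| < eta ->
    V q /\ `|f q - f q' - \sum_i (q - q') 0 i *: pderiv f i q0| <= e * `|q - q'|.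
Proof.
move=> oV [df cdf] Vq0 e0.
have e1 : 0 < e / n.+1%:R by rewrite divr_gt0.
have N1 : \forall q \near q0, V q by exact: open_nbhs_nbhs.
have N2 : \forall q \near q0, forall i, `|pderiv f i q0 - pderiv f i q| <= e / n.+1%:R.
  apply: (@filter_forall _ _ (fun i q => `|pderiv f i q0 - pderiv f i q| <= e / n.+1%:R) (nbhs q0) _) => i.
  by have /cvgrPdist_le/(_ _ e1) := cdf i q0 Vq0.
have : \forall q \near q0, V q /\ forall i, `|pderiv f i q0 - pderiv f i q| <= e / n.+1%:R.
  by near=> q; split; near: q.
move=> /nbhs_ballP[eta /= eta0 Heta]; exists eta => // q q' qe q'e.
have {}Heta x : `|x - q0| < eta -> V x /\ forall i, `|pderiv f i q0 - pderiv f i x| <= e / n.+1%:R.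
  by move=> xe; apply: Heta; rewrite -ball_normE /ball_/= distrC.
split; first by case: (Heta q qe).
pose v := q - q'.
have seg (t : R) : 0 <= t <= 1 -> `|q' + t *: v - q0| < eta.
  move=> /andP[t0 t1].
  have -> : q' + t *: v - q0 = t *: (q - q0) + (1 - t) *: (q' - q0).
    by apply/rowP => l; rewrite !mxE; ring.
  rewrite (le_lt_trans (ler_normD _ _))// !normrZ !ger0_norm//; last by lra.
  have [->|t_neq0] := eqVneq t 0; first by rewrite mul0r add0r subr0 mul1r.
  have tpos : 0 < t by rewrite lt_neqAle eq_sym t_neq0.
  have : t * `|q - q0| < t * eta by rewrite ltr_pM2l.
  have : (1 - t) * `|q' - q0| <= (1 - t) * eta by apply: ler_wpM2l; [lra|exact: ltW].
  by lra.
apply/rV_norm_le; first by rewrite mulr_ge0// ltW.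
move=> j; pose L := \sum_i v 0 i * pderiv f i q0 0 j.
pose g (t : R) := f (q' + t *: v) 0 j - L * t.
have -> : (f q - f q' - \sum_i (q - q') 0 i *: pderiv f i q0) 0 j = g 1 - g 0.
  have vE : q' + v = q by rewrite /v addrC subrK.
  rewrite /g scale1r scale0r addr0 mulr1 mulr0 subr0 vE !rV_subE summxE.
  by under eq_bigr do rewrite mxE; rewrite addrAC.
have -> : e * `|q - q'| = e * `|q - q'| * (1 - 0) by rewrite subr0 mulr1.
apply: (@MVT_norm _ g (fun t => \sum_i v 0 i * (pderiv f i (q' + t *: v) 0 j - pderiv f i q0 0 j))) => // t t01.
- have [Vx _] := Heta _ (seg t t01).
  have D : is_derive t 1 (fun t => f (q' + t *: v) 0 j) ('D_v f (q' + t *: v) 0 j).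
    have := is_derive_line_coord v j (df _ Vx) => D.
    have := @is_derive_shift _ (fun s => f (q' + t *: v + s *: v) 0 j) t (- t) _.
    rewrite subrr => /(_ _ D); congr is_derive; apply/funext => s.
    by rewrite -addrA -scalerDl; congr (f (_ + _ *: _) _ _); ring.
  have I : is_derive (t : R) 1 (id : R -> R) 1 by exact: is_derive_id.
  have := is_derive_subZ L D I; rewrite mulr1 derive_coord; last exact: df.
  congr is_derive; rewrite /L -sumrB; apply: eq_bigr => i _; ring.
- have [_ Hx] := Heta _ (seg t t01).
  apply: le_trans (ler_norm_sum _ _ _) _.
  apply: (@le_trans _ _ (\sum_(i < n) `|v| * (e / n.+1%:R))).
    apply: ler_sum => i _; rewrite normrM ler_pM//; first exact: rV_norm_coord.
    by rewrite -rV_subE (le_trans (rV_norm_coord _ _))// distrC.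
  rewrite sumr_const card_ord.
  have -> : (`|v| * (e / n.+1%:R)) *+ n = (e * `|v|) * (n%:R / n.+1%:R).
    by rewrite -mulr_natr; move: (n.+1%:R^-1) => w; ring.
  by rewrite ler_piMr ?mulr_ge0 ?(ltW e0)// ler_pdivrMr// mul1r ler_nat.
Unshelve. all: by end_near. Qed.

End StrictDifferentiability.

(** Row vectors as a complete normed space, the setting of the fixed point theorem in
    [local_surjective]. *)
HB.instance Definition _ (R : realType) (n : nat) := NormedModule.on 'rV[R]_n.

(** * Local inversion of a map that is close to the identity *)

Section LocalInverse.
Variables (R : realType) (n : nat) (F : 'rV[R]_n -> 'rV[R]_n) (q0 : 'rV[R]_n) (eta : R).
Implicit Types q y : 'rV[R]_n.
Hypothesis eta0 : 0 < eta.
Hypothesis F_id : forall q q', `|q - q0| <= eta -> `|q' - q0| <= eta ->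
  `|F q - F q' - (q - q')| <= 2^-1 * `|q - q'|.

Lemma local_injective q q' : `|q - q0| <= eta -> `|q' - q0| <= eta ->
  `|q - q'| <= 2 * `|F q - F q'|.
Proof.
move=> qe q'e; have := F_id qe q'e.
have := ler_normB (F q - F q') (F q - F q' - (q - q')).
by rewrite subKr; lra.
Qed.

(** A solution is a fixed point of [T], a contraction of ratio 1/2. [T] moves [q0] by at most
    [eta / 2], so it preserves the closed ball. *)
Lemma local_surjective y : `|y - F q0| <= eta / 2 ->
  exists2 q, `|q - q0| <= eta & F q = y.
Proof.
move=> ye; pose T q : 'rV[R]_n := q - F q + y; pose U : set 'rV[R]_n := closed_ball q0 eta.
have UE q : U q <-> `|q - q0| <= eta.
  by rewrite /U closed_ballE// /closed_ball_/= distrC.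
have q0U : `|q0 - q0| <= eta by rewrite subrr normr0 ltW.
have TT q q' : `|q - q0| <= eta -> `|q' - q0| <= eta -> `|T q - T q'| <= 2^-1 * `|q - q'|.
  move=> qe q'e; rewrite -normrN; have := F_id qe q'e; congr (`| _ | <= _).
  by rewrite /T; apply/rowP => j; rewrite !mxE; ring.
have TU : {homo T : x / U x >-> U x}.
  move=> q /UE qe; apply/UE; rewrite -[T q - q0](subrKA (T q0)).
  rewrite (le_trans (ler_normD _ _))//.
  have -> : T q0 - q0 = y - F q0 by rewrite /T; apply/rowP => j; rewrite !mxE; ring.
  by have := TT _ _ qe q0U; lra.
have [] := @banach_fixed_point R 'rV[R]_n U (mkfun_fun TU).
- have q2 : 0 <= (2^-1 : R) by rewrite invr_ge0.
  exists (NngNum q2); split => /=; first by rewrite invf_lt1 ?ltr1n.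
  by move=> [q q'] [/= /UE qe /UE q'e]; exact: TT.
- exact: closed_ball_closed.
- by exists q0; apply/UE.
move=> q /UE qe qT; exists q => //; move/eqP: qT.
by rewrite /= /T -subr_eq0 opprD addrA opprB addrCA subrr addr0 subr_eq0 => /eqP.
Qed.

Definition local_inverse y := xget q0 [set q | `|q - q0| <= eta /\ F q = y].

Lemma local_inverseP y : `|y - F q0| <= eta / 2 ->
  `|local_inverse y - q0| <= eta /\ F (local_inverse y) = y.
Proof.
move=> ye; rewrite /local_inverse; case: xgetP => [q -> //|H].
by have [q qe Fq] := local_surjective ye; have := H q; case.
Qed.

Lemma local_inverse_continuous y : `|y - F q0| < eta / 2 ->
  {for y, continuous local_inverse}.
Proof.
move=> ye; apply/(@cvgrPdist_le _ _ _ (nbhs y)) => e e0.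
have e2 : 0 < e / 2 by rewrite divr_gt0.
have N1 : \forall y' \near y, `|y' - F q0| < eta / 2.
  have : {for y, continuous (fun y' => `|y' - F q0|)}.
    apply: (@continuous_comp _ _ _ (fun y' => y' - F q0) Num.norm); last exact: norm_continuous.
    by apply: (@continuousB _ _ _ id); [exact: cvg_id|exact: cst_continuous].
  by move=> /(cvgr_lt _)/(_ _ ye).
have N2 : \forall y' \near y, `|y - y'| <= e / 2.
  by have /(@cvgrPdist_le _ _ _ (nbhs y))/(_ _ e2) : (id : 'rV[R]_n -> 'rV[R]_n) @ y --> y by exact: cvg_id.
near=> y'.
have [g1 Fg1] := local_inverseP (ltW ye).
have [|g2 Fg2] := @local_inverseP y'; first by apply: ltW; near: y'.
rewrite (le_trans (local_injective g1 g2))// Fg1 Fg2.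
have : `|y - y'| <= e / 2 by near: y'.
lra.
Unshelve. all: by end_near. Qed.

End LocalInverse.

(** * The surface as a local graph, and the Jacobian of the field on it *)

Section Surface.
Variable R : realType.
Implicit Types (x p v w : 'rV[R]_3).

Lemma mul_rV_jacobian (phi : 'rV[R]_2 -> 'rV[R]_3) (q v : 'rV[R]_2) :
  v *m col_mx (pderiv phi 0 q) (pderiv phi 1 q) = \sum_i v 0 i *: pderiv phi i q.
Proof.
rewrite (mulmx_sum_row v (col_mx (pderiv phi 0 q) (pderiv phi 1 q) : 'M[R]_(2, 3))).
apply: eq_bigr => i _; congr (_ *: _).
apply/rowP => j; rewrite mxE [LHS]mxE.
case: splitP => l; rewrite ord1 => il.
- have -> : i = 0 by apply/val_inj; rewrite /= il.
  by [].
- have -> : i = 1 by apply/val_inj; rewrite /= il.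
  by [].
Qed.

Lemma rV_mul_norm (m n : nat) (B : 'M[R]_(m, n)) :
  exists2 C : R, 0 < C & forall v : 'rV[R]_m, `|v *m B| <= C * `|v|.
Proof.
pose C := 1 + \sum_i \sum_j `|B i j|.
have C0 : 0 < C.
  by rewrite ltr_pwDl// sumr_ge0// => i _; rewrite sumr_ge0.
exists C => // v; apply/rV_norm_le; first by rewrite mulr_ge0// ltW.
move=> j; rewrite mxE (le_trans (ler_norm_sum _ _ _))//.
apply: (@le_trans _ _ (\sum_i `|B i j| * `|v|)).
  by apply: ler_sum => i _; rewrite normrM mulrC ler_wpM2l// rV_norm_coord.
rewrite -mulr_suml ler_wpM2r// /C (@le_trans _ _ (\sum_i \sum_j `|B i j|))//; last by rewrite lerDr.
apply: ler_sum => i _; rewrite (bigD1 j)//= lerDl; exact: sumr_ge0.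
Qed.

Lemma mulmxr_continuous (m n : nat) (B : 'M[R]_(m, n)) :
  continuous (fun v : 'rV[R]_m => v *m B).
Proof.
move=> v; have [C C0 HC] := rV_mul_norm B.
apply/(@cvgrPdist_le _ _ _ (nbhs v)) => e e0.
have eC : 0 < e / C by rewrite divr_gt0.
have N : \forall w \near v, `|v - w| <= e / C.
  by have /(@cvgrPdist_le _ _ _ (nbhs v))/(_ _ eC) : (id : 'rV[R]_m -> 'rV[R]_m) @ v --> v by exact: cvg_id.
near=> w; rewrite -mulmxBl (le_trans (HC _))// mulrC -ler_pdivlMr//.
Unshelve. all: by end_near. Qed.

(** [F], the parametrization followed by the projection [B], has derivative [M *m B = 1%:M] at [q0],
    so it is locally invertible; [gamma] is the height above the surface point with the same
    projection. Moving along [ev k] keeps the projection because [ev k *m B = 0]. *)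
Lemma surface_graph (Omega S : set 'rV[R]_3) p : regular_surface Omega S -> S p ->
  exists (k : 'I_3) (gamma : 'rV[R]_3 -> R),
    (forall x (t : R), gamma (x + t *: ev k) = gamma x + t) /\
    \forall x \near p, {for x, continuous gamma} /\ (S x <-> gamma x = 0).
Proof.
move=> [_ [_ /(_ p) regS]] Sp.
have [U [V [phi [psi [oU [Up [oV [C1phi [fphi [Hphi [Hpsi cpsi]]]]]]]]]]] := regS Sp.
have SUp : (S `&` U) p by [].
pose q0 := psi p; have [Vq0 phiq0] := Hpsi p SUp.
pose M : 'M[R]_(2, 3) := col_mx (pderiv phi 0 q0) (pderiv phi 1 q0).
have [k [B [n [MB kB nk E]]]] := row_free_frame (fphi _ Vq0 : row_free M).
have [C C0 HC] := rV_mul_norm B.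
pose F q := phi q *m B.
(* [B] enlarges norms by at most [C], so this accuracy for [phi] makes [F] minus the identity
   1/2-Lipschitz. *)
have e0 : 0 < (2 * C)^-1 by rewrite invr_gt0 mulr_gt0.
have [eta1 eta10 Heta] := C1_strict_differentiable oV C1phi Vq0 e0.
pose eta := eta1 / 2.
have eta0 : 0 < eta by rewrite divr_gt0.
have lt_eta q : `|q - q0| <= eta -> `|q - q0| < eta1.
  by move=> /le_lt_trans; apply; rewrite /eta; lra.
have F_id q q' : `|q - q0| <= eta -> `|q' - q0| <= eta ->
    `|F q - F q' - (q - q')| <= 2^-1 * `|q - q'|.
  move=> /lt_eta qe /lt_eta q'e; have [_] := Heta q q' qe q'e.
  rewrite -mul_rV_jacobian -/M => Hq.
  have -> : F q - F q' - (q - q') = (phi q - phi q' - (q - q') *m M) *m B.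
    by rewrite 2!mulmxBl -[_ *m M *m B]mulmxA MB mulmx1.
  rewrite (le_trans (HC _))// (le_trans (ler_wpM2l (ltW C0) Hq))// mulrA.
  by rewrite invfM mulrCA divff ?gt_eqF// mulr1.
have V_eta q : `|q - q0| <= eta -> V q.
  by move=> /lt_eta qe; case: (Heta q q qe qe).
pose g : 'rV[R]_2 -> 'rV[R]_2 := local_inverse F q0 eta.
pose gamma x := x 0 k - phi (g (x *m B)) 0 k.
have Fq0 : F q0 = p *m B by rewrite /F phiq0.
have eta2 : 0 < eta / 2 by rewrite divr_gt0.
exists k, gamma; split.
  by move=> x t; rewrite /gamma comp_addZ eqxx mul1r mulmxDl -scalemxAl kB scaler0 addr0 addrAC.
have N1 : \forall x \near p, `|x *m B - F q0| < eta / 2.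
  have /(@cvgrPdist_lt _ _ _ (nbhs p))/(_ _ eta2) := @mulmxr_continuous _ _ B p.
  by rewrite Fq0; apply: filterS => x; rewrite distrC.
(* Embeddedness enters here: continuity of [psi] forces points of [S] near [p] to have parameters
   near [q0], so no other sheet of [S] comes close. *)
have N2 : \forall x \near p, S x -> U x /\ `|psi x - q0| <= eta.
  have NU : \forall x \near p, U x by exact: open_nbhs_nbhs.
  move/subspace_continuousP: cpsi => /(_ p SUp) /cvgrPdist_le/(_ _ eta0).
  rewrite near_withinE => NP; near=> x => Sx.
  have Ux : U x by near: x.
  split => //; rewrite distrC; have : (S `&` U) x by [].
  by near: x.
near=> x.
have xB : `|x *m B - F q0| < eta / 2 by near: x.
have xS : S x -> U x /\ `|psi x - q0| <= eta by near: x.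
have [gx Fgx] := local_inverseP eta0 F_id (ltW xB).
split.
- apply: (@continuousB _ _ _ (fun y : 'rV[R]_3 => y 0 k)); first exact: coord_continuous.
  have c1 : {for x, continuous (fun y : 'rV[R]_3 => g (y *m B))}.
    apply: (@continuous_comp _ _ _ (fun y : 'rV[R]_3 => y *m B) g); first exact: mulmxr_continuous.
    exact: (local_inverse_continuous eta0 F_id xB).
  have c2 : {for x, continuous (fun y : 'rV[R]_3 => phi (g (y *m B)))}.
    apply: (@continuous_comp _ _ _ (fun y : 'rV[R]_3 => g (y *m B)) phi) => //.
    by apply: differentiable_continuous; apply: C1phi.1; exact: V_eta.
  apply: (@continuous_comp _ _ _ (fun y : 'rV[R]_3 => phi (g (y *m B))) (fun w : 'rV[R]_3 => w 0 k)) => //.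
  exact: coord_continuous.
- split=> [Sx|/eqP].
  + have [Ux psix] := xS Sx; have [_ phipsi] := Hpsi x (conj Sx Ux).
    rewrite /gamma; suff -> : g (x *m B) = psi x by rewrite phipsi subrr.
    have := local_injective F_id gx psix.
    rewrite Fgx [F (psi x)]/F phipsi subrr normr0 mulr0 normr_le0 subr_eq0.
    by move=> /eqP.
  + rewrite subr_eq0 => /eqP xk.
    suff -> : x = phi (g (x *m B)) by case: (Hphi _ (V_eta _ gx)) => -[].
    apply/eqP; rewrite -subr_eq0; set w := x - _.
    have wB : w *m B = 0 by rewrite /w mulmxBl -[phi _ *m B]/(F _) Fgx subrr.
    have wk : w 0 k = 0 by rewrite /w rV_subE xk subrr.
    (* A vector with zero projection is a multiple of [ev k], and its [k]-th coordinate is zero as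
       well. *)
    have wE : w = (w *m n) *m ev k.
      by rewrite -[LHS]mulmx1 -E mulmxDr !mulmxA wB mul0mx add0r.
    have wn : w *m n = 0.
      apply/matrixP => i j; rewrite !ord1 [RHS]mxE.
      by move: wk; rewrite {1}wE mxE big_ord1 [ev k 0 k]mxE !eqxx mulr1.
    by rewrite wE wn mul0mx.
Unshelve. all: by end_near. Qed.

Lemma ord3_sym (d : 'I_3 -> 'I_3 -> R) :
  d 0 1 = d 1 0 -> d 2 0 = d 0 2 -> d 1 2 = d 2 1 -> forall i j, d i j = d j i.
Proof.
move=> d01 d20 d12 i j.
have all3 (l : 'I_3) : [\/ l = 0, l = 1 | l = 2].
  by case: l => [[|[|[|//]]]] Hl; [constructor 1|constructor 2|constructor 3]; exact: val_inj.
by case: (all3 i) => ->; case: (all3 j) => ->.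
Qed.

Lemma curl3_eq0_sym (H : 'rV[R]_3 -> 'rV[R]_3) p : curl3 H p = 0 ->
  forall i j, pderiv H i p 0 j = pderiv H j p 0 i.
Proof.
move=> curlH i j; have c0 l : curl3 H p 0 l = 0 by rewrite curlH mxE.
have := c0 0; have := c0 1; have := c0 2; rewrite !mxE /= /comp.
move=> /eqP; rewrite subr_eq0 => /eqP c01 /eqP; rewrite subr_eq0 => /eqP c20 /eqP.
rewrite subr_eq0 => /eqP c12.
exact: (@ord3_sym (fun l m => pderiv H l p 0 m)).
Qed.

Lemma derive_chain (l m n : nat) (f : 'rV[R]_l -> 'rV[R]_m) (g : 'rV[R]_m -> 'rV[R]_n)
    (q v : 'rV[R]_l) : differentiable f q -> differentiable g (f q) ->
  'D_v (g \o f) q = 'D_('D_v f q) g (f q).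
Proof.
move=> df dg; rewrite deriveE; last exact: differentiable_comp.
by rewrite diff_comp// [RHS]deriveE// [X in _ = 'd g (f q) X]deriveE.
Qed.

Lemma pderiv_eq0_on_surface (Omega : set 'rV[R]_3) (H : 'rV[R]_3 -> 'rV[R]_3) c p :
  C1_on Omega H ->
  (forall x, Omega x -> div3 H x = 0) -> (forall x, Omega x -> curl3 H x = 0) ->
  regular_surface Omega [set x | Omega x /\ H x = c] ->
  Omega p -> H p = c -> forall i, pderiv H i p = 0.
Proof.
move=> [dH _] divH curlH [_ [_ /(_ p) regS]] Op Hp.
have [U [V [phi [psi [oU [Up [oV [C1phi [fphi [Hphi [Hpsi cpsi]]]]]]]]]]] := regS (conj Op Hp).
have [Vq phiq] := Hpsi p (conj (conj Op Hp) Up); set q := psi p in Vq phiq.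
pose J : 'M[R]_3 := \matrix_(i, j) pderiv H i p 0 j.
suff J0 : J = 0.
  by move=> i; apply/rowP => j; have := congr1 (fun A : 'M[R]_3 => A i j) J0; rewrite !mxE.
apply: (symmetric_traceless_eq0 (fphi q Vq : row_free (_ : 'M[R]_(2, 3)))).
(* By the chain rule, row [i] of the product is the [i]-th partial derivative of [H \o phi], which
   is constant on [V]. *)
- apply/row_matrixP => i; rewrite row_mul row0 rowE mul_rV_jacobian.
  rewrite (bigD1 i)//= big1 => [|l li]; last by rewrite mxE eqxx (negPf li) scale0r.
  rewrite mxE !eqxx scale1r addr0; apply/rowP => j; rewrite mxE [RHS]mxE.
  have dphi : differentiable phi q by exact: C1phi.1.
  have dHp : differentiable H (phi q) by rewrite phiq; exact: dH.
  have -> : \sum_l pderiv phi i q 0 l * J l j = 'D_(pderiv phi i q) H p 0 j.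
    by rewrite derive_coord; [apply: eq_bigr => l _; rewrite mxE|exact: dH].
  have DE := derive_chain (ev i) dphi dHp.
  rewrite phiq in DE; rewrite -/(pderiv phi i q) in DE; rewrite -DE.
  have N : \forall y \near q, (H \o phi) y = cst c y.
    have : \forall y \near q, V y by exact: open_nbhs_nbhs.
    by apply: filterS => y /Hphi[[[_ Hy] _] _].
  by rewrite (near_eq_derive _ N) derive_cst mxE.
- by apply/matrixP => i j; rewrite !mxE; exact: (curl3_eq0_sym (curlH p Op) j i).
- by rewrite -[RHS](divH p Op) /mxtrace; apply: eq_bigr => i _; rewrite mxE.
Qed.

End Surface.

(** * Extension by zero across the surface *)

Section Gluing.
Variable R : realType.
Implicit Types (f gamma : 'rV[R]_3 -> R) (x v : 'rV[R]_3).

Definition glue gamma f x : R := if 0 < gamma x then f x else 0.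

Lemma glue_continuous gamma f x : {for x, continuous gamma} ->
  {for x, continuous f} -> (gamma x = 0 -> f x = 0) ->
  {for x, continuous (glue gamma f)}.
Proof.
move=> cg cf f0; apply/(@cvgrPdist_le _ _ _ (nbhs x)) => e e0.
have /cvgrPdist_le/(_ _ e0) N := cf; rewrite /glue.
case: (ltgtP (gamma x) 0) => [g0|g0|/f0 fx].
- have /(cvgr_lt _)/(_ _ g0) N' := cg; near=> y.
  have g0' : gamma y < 0 by near: y.
  by rewrite ltNge (ltW g0')/= subrr normr0 ltW.
- have /(cvgr_gt _)/(_ _ g0) N' := cg; near=> y.
  have -> : 0 < gamma y by near: y.
  by near: y.
- near=> y; case: ifP => _; last by rewrite subrr normr0 ltW.
  by rewrite -fx; near: y.
Unshelve. all: by end_near. Qed.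

(** Off [gamma = 0] continuity of [gamma] fixes the branch. On it both branches are $o(t)$, so the
    branch may switch arbitrarily often along the line. *)
Lemma glue_is_derive gamma f x i (a : R) : {for x, continuous gamma} ->
  is_derive (0 : R) 1 (fun t => f (x + t *: ev i)) a ->
  (gamma x = 0 -> f x = 0 /\ a = 0) ->
  is_derive (0 : R) 1 (fun t => glue gamma f (x + t *: ev i)) (if 0 < gamma x then a else 0).
Proof.
move=> cg /is_derive_normP df f0; apply/is_derive_normP => e e0.
have N := df e e0; rewrite scale0r addr0 in N *.
have L : (fun s : R => gamma (x + s *: ev i)) @ (0 : R) --> gamma x.
  apply: (@cvg_comp _ _ _ (fun s : R => x + s *: ev i) gamma _ (nbhs x)); last exact: cg.
  by have := @line_continuous _ x i 0; rewrite /continuous_at scale0r addr0.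
rewrite /glue; case: (ltgtP (gamma x) 0) => [g0|g0|/f0[fx a0]].
- have /(cvgr_lt _)/(_ _ g0) N' := L; near=> h.
  have g0' : gamma (x + h *: ev i) < 0 by near: h.
  by rewrite add0r ltNge (ltW g0')/= mul0r !subr0 normr0 mulr_ge0// ltW.
- have /(cvgr_gt _)/(_ _ g0) N' := L; near=> h.
  have g0' : 0 < gamma (x + h *: ev i) by near: h.
  by rewrite {1}add0r g0'; near: h.
- rewrite fx a0 in N; near=> h; case: ifP => _.
    by near: h.
  by rewrite mul0r !subr0 normr0 mulr_ge0// ltW.
Unshelve. all: by end_near. Qed.

End Gluing.

Lemma continuous_bounded_on_ball (R : realType) (u : 'rV[R]_3 -> R) p (r : R) : 0 < r ->
  (forall x, `|x - p| <= r -> {for x, continuous u}) ->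
  exists M : R, forall x, `|x - p| <= r -> `|u x| <= M.
Proof.
move=> r0 cu; pose K : set 'rV[R]_3 := closed_ball p r.
have KE x : K x <-> `|x - p| <= r.
  by rewrite /K closed_ballE// /closed_ball_/= distrC.
have cK : compact K.
  apply: bounded_closed_compact; last exact: closed_ball_closed.
  exists (`|p| + r); split => [|M dM y /KE yr /=]; first exact: num_real.
  rewrite (le_trans _ (ltW dM))// -[y](subrK p) addrC (le_trans (ler_normD _ _))//.
  by rewrite lerD2l.
have K0 : K !=set0 by exists p; apply/KE; rewrite subrr normr0 ltW.
have cN : {within K, continuous (fun x => `|u x|)}.
  apply: continuous_in_subspaceT => x; rewrite inE => /KE xr.
  by apply: (@continuous_comp _ _ _ u Num.norm); [exact: cu|exact: norm_continuous].
have [z _ zM] := EVT_max_rV K0 cK cN.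
by exists `|u z| => x xr; apply: zM; rewrite inE; apply/KE.
Qed.

(** * The contradiction at a point just above the surface *)

Unset Implicit Arguments.
Set Strict Implicit.

Theorem theorem2p1 (R : realType) (Omega : set 'rV[R]_3)
  (H : 'rV[R]_3 -> 'rV[R]_3) :
  Omega !=set0 -> open Omega -> connected Omega ->
  C1_on Omega H ->
  (forall x, Omega x -> div3 H x = 0) ->
  (forall x, Omega x -> curl3 H x = 0) ->
  forall c : 'rV[R]_3, ~ regular_surface Omega [set x | Omega x /\ H x = c].
Proof.
move=> _ oOmega _ C1H divH curlH c regS.
have DH0 := pderiv_eq0_on_surface C1H divH curlH regS.
have [dH cdH] := C1H.
have [p [Op Hp]] := regS.1.
have [k [gamma [gammaD Ngamma]]] := surface_graph regS (conj Op Hp).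
have : \forall x \near p, Omega x /\ ({for x, continuous gamma} /\
    ([set x | Omega x /\ H x = c] x <-> gamma x = 0)).
  near=> x; split; last by near: x.
  by near: x; exact: open_nbhs_nbhs.
move=> /nbhs_ballP[rho1 /= rho10 Hrho1].
pose rho := rho1 / 2.
have rho0 : 0 < rho by rewrite divr_gt0.
have {}Hrho1 (x : 'rV[R]_3) : `|x - p| <= rho -> [/\ Omega x, {for x, continuous gamma}
    & (Omega x /\ H x = c) <-> gamma x = 0].
  move=> xr; have [|Ox [cx Sx]] := Hrho1 x; last by [].
  by rewrite -ball_normE /ball_/= distrC (le_lt_trans xr)// /rho; lra.
have p_rho : `|p - p| <= rho by rewrite subrr normr0 ltW.
have gamma_p : gamma p = 0 by have [_ _] := Hrho1 p p_rho; case => + _; apply.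
pose G j := glue gamma (fun x => H x 0 j - c 0 j).
pose D i j := glue gamma (fun x => pderiv H i x 0 j).
have zeroS (x : 'rV[R]_3) : `|x - p| <= rho -> gamma x = 0 -> H x = c /\ forall i, pderiv H i x = 0.
  move=> xr gx; have [_ _ [_ /(_ gx)[Ox Hx]]] := Hrho1 x xr.
  by split => //; exact: DH0.
have G_eq0 j (x : 'rV[R]_3) : gamma x <= 0 -> G j x = 0.
  by move=> gx; rewrite /G /glue ltNge gx.
have cG j (x : 'rV[R]_3) : `|x - p| <= rho -> {for x, continuous (G j)}.
  move=> xr; have [Ox cx _] := Hrho1 x xr; apply: glue_continuous => //.
  - apply: (@continuousB _ _ _ (fun x => H x 0 j)); last exact: cst_continuous.
    apply: (@continuous_comp _ _ _ H (fun w : 'rV[R]_3 => w 0 j)); last exact: coord_continuous.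
    by apply: differentiable_continuous; exact: dH.
  - by move=> /(zeroS x xr)[-> _]; rewrite subrr.
have cD i j (x : 'rV[R]_3) : `|x - p| <= rho -> {for x, continuous (D i j)}.
  move=> xr; have [Ox cx _] := Hrho1 x xr; apply: glue_continuous => //.
  - apply: (@continuous_comp _ _ _ (pderiv H i) (fun w : 'rV[R]_3 => w 0 j)); last exact: coord_continuous.
    exact: cdH.
  - by move=> /(zeroS x xr)[_ ->]; rewrite mxE.
have dG i j (x : 'rV[R]_3) : `|x - p| <= rho ->
    is_derive (0 : R) 1 (fun t => G j (x + t *: ev i)) (D i j x).
  move=> xr; have [Ox cx _] := Hrho1 x xr; apply: glue_is_derive => //.
  - rewrite -[X in is_derive _ _ _ X]subr0; apply: is_deriveB.
    by apply: is_derive_line_coord; exact: dH.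
  - by move=> /(zeroS x xr)[-> ->]; rewrite subrr mxE.
have D_sym i j (x : 'rV[R]_3) : `|x - p| <= rho -> D i j x = D j i x.
  move=> xr; have [Ox cx _] := Hrho1 x xr; rewrite /D /glue; case: ifP => // _.
  exact: curl3_eq0_sym (curlH x Ox) i j.
have D_trace (x : 'rV[R]_3) : `|x - p| <= rho -> \sum_i D i i x = 0.
  move=> xr; have [Ox cx _] := Hrho1 x xr; rewrite /D /glue; case: (0 < gamma x); last exact: big1.
  exact: divH.
pose tau := rho / 2.
have tau0 : 0 < tau by rewrite divr_gt0.
have tau_rho : tau < rho by rewrite /tau; lra.
have [_ cgp _] := Hrho1 p p_rho.
(* With [|gamma| < tau] near [p], points at depth [tau] below the base plane lie under the surface,
   where [G] is zero. *)
have /cvgrPdist_lt/(_ _ tau0)/nbhs_ballP[d1 /= d10 Hd1] := cgp.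
pose delta := Num.min d1 tau.
have delta0 : 0 < delta by rewrite lt_min d10.
have delta_tau : delta <= tau by rewrite ge_min lexx orbT.
have G_bottom j (z : 'rV[R]_3) : `|z - p| < delta -> z 0 k = p 0 k -> G j (z + (- tau) *: ev k) = 0.
  move=> zd _; apply: G_eq0; rewrite gammaD subr_le0.
  have : `|gamma p - gamma z| < tau.
    by apply: Hd1; rewrite -ball_normE /ball_/= distrC (lt_le_trans zd)// ge_min lexx.
  by rewrite gamma_p ltr_norml; lra.
have [h Hh] := harmonic_potential delta0 delta_tau tau_rho cG cD dG D_sym D_trace G_bottom.
pose r := delta / 2.
have r0 : 0 < r by rewrite divr_gt0.
have r_delta (x : 'rV[R]_3) : `|x - p| <= r -> `|x - p| < delta.
  by move=> /le_lt_trans; apply; rewrite /r; lra.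
have [M HM] : exists M : R, forall x, `|x - p| <= r -> `|h x| <= M.
  apply: continuous_bounded_on_ball => // x /r_delta xd.
  by have [[]] := Hh x xd.
have hM (x : 'rV[R]_3) : `|x - p| <= r -> harmonic_at h x /\ `|h x| <= M.
  by move=> xr; split; [have [] := Hh x (r_delta x xr)|exact: HM].
have h_below (x : 'rV[R]_3) : `|x - p| <= r -> gamma x <= 0 -> h x = 0.
  move=> xr gx; have [_ _] := Hh x (r_delta x xr); apply => t t0.
  by apply: G_eq0; rewrite -scaleNr gammaD; lra.
(* Matches [48 * L <= r] in [harmonic_continuation], used with [L = gamma x]. The bound [r / 8] on
   [eta] keeps the points below within [r / 8 + 2 * (r / 48) <= r / 4] of [p]. *)
have r48 : 0 < r / 48 by rewrite divr_gt0.
have /cvgrPdist_lt/(_ _ r48)/nbhs_ballP[d2 /= d20 Hd2] := cgp.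
pose eta := Num.min d2 (r / 8).
have eta0 : 0 < eta by rewrite lt_min d20 divr_gt0.
have eta_r : eta <= r / 8 by rewrite ge_min lexx orbT.
have h_eq0 (x : 'rV[R]_3) : `|x - p| < eta -> h x = 0.
  move=> xe; have xr : `|x - p| <= r / 8 by rewrite ltW// (lt_le_trans xe).
  have [gx|gx] := leP (gamma x) 0; first by apply: h_below => //; lra.
  have gr : gamma x < r / 48.
    have : `|gamma p - gamma x| < r / 48.
      by apply: Hd2; rewrite -ball_normE /ball_/= distrC (lt_le_trans xe)// ge_min lexx.
    by rewrite gamma_p sub0r normrN gtr0_norm.
  (* The point of the surface vertically below [x]: here [gamma x0 = 0], so [h] vanishes from [x0]
     downwards. *)
  pose x0 := x - gamma x *: ev k.
  have x0p (t : R) : 0 <= t <= gamma x -> `|x0 - t *: ev k - p| <= r / 4.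
    move=> t01; have -> : x0 - t *: ev k - p = (x - p) - (gamma x + t) *: ev k.
      by apply/rowP => l; rewrite !mxE; ring.
    rewrite (le_trans (ler_normB _ _))//.
    have := rV_norm_scale_ev (gamma x + t) k; rewrite [`|gamma x + t|]ger0_norm; lra.
  have -> : x = x0 + gamma x *: ev k by rewrite subrK.
  apply: (harmonic_continuation gx _ hM); first by lra.
  - by have := x0p 0; rewrite scale0r subr0; apply; rewrite lexx ltW.
  - move=> t t01; apply: h_below; first by have := x0p t t01; lra.
    by rewrite /x0 -!scaleNr !gammaD; lra.
(* Strictly above the surface, yet [h] vanishes around it. So its gradient [G], equal to [H - c]
   there, is zero, which would put [x] on the level set. *)
pose x := p + (eta / 2) *: ev k.
have eta2 : 0 < eta / 2 by rewrite divr_gt0.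
have xe : `|x - p| < eta.
  rewrite /x addrC addKr (le_lt_trans (rV_norm_scale_ev _ _))// gtr0_norm//; lra.
have xr : `|x - p| <= r by rewrite ltW// (lt_trans xe)//; lra.
have gx : gamma x = eta / 2 by rewrite /x gammaD gamma_p add0r.
have [Ox _ Sx] := Hrho1 x ltac:(by have := r_delta x xr; lra).
suff Hx : H x = c by have := Sx.1 (conj Ox Hx); rewrite gx; lra.
apply/rowP => i; apply/eqP; rewrite -subr_eq0; apply/eqP.
have [_ /(_ i) dh _] := Hh x (r_delta x xr).
have -> : H x 0 i - c 0 i = G i x by rewrite /G /glue gx eta2.
have N : \forall s \near (0 : R), h (x + s *: ev i) = cst 0 s.
  have : \forall y \near x, `|y - p| < eta.
    have : {for x, continuous (fun y => `|y - p|)}.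
      apply: (@continuous_comp _ _ _ (fun y => y - p) Num.norm); last exact: norm_continuous.
      by apply: (@continuousB _ _ _ id); [exact: cvg_id|exact: cst_continuous].
    by move=> /(cvgr_lt _)/(_ _ xe).
  move=> Nx; have := @line_continuous _ x i 0; rewrite /continuous_at scale0r addr0.
  move=> /(_ _ Nx) N; near=> s; apply: h_eq0; near: s; exact: N.
have [_ <-] := dh.
by rewrite (near_eq_derive _ N) derive_cst.
Unshelve. all: by end_near. Qed.
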